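(* Let $(M,\nabla)$ be a $2$-dimensional smooth torsion-free affine manifold, and let $\phi$ be a symmetric $(0,2)$-tensor field on $M$. Then the following assertions are equivalent: (1) $(M,\nabla)$ is an affine Szabó manifold. (2) The deformed Riemannian extension $(T^*M,g_{(\nabla,\phi)})$ of $(M,\nabla)$ is a pseudo-Riemannian nilpotent Szabó manifold of neutral signature.
   Context: All manifolds, tensor fields and connections are $C^\infty$. Affine Szabó: for an affine manifold $(M,\nabla)$ ($\nabla$ torsion-free) with curvature operator $\mathcal{R}^\nabla(X,Y)Z=\nabla_X\nabla_YZ-\nabla_Y\nabla_XZ-\nabla_{[X,Y]}Z$ and $X\in T_pM$, the affine Szabó operator $\mathcal{S}^\nabla(X):T_pM\to T_pM$ is $\mathcal{S}^\nabla(X)Y=(\nabla_X\mathcal{R}^\nabla)(Y,X)X$. $(M,\nabla)$ is affine Szabó at $p$ if $\mathcal{S}^\nabla(X)$ has the same characteristic polynomial for every $X\in T_pM$; it is affine Szabó if it is affine Szabó at each $p\in M$. Deformed Riemannian extension: let $n=\dim M$ and $\pi:T^*M\to M$ the projection. Local coordinates $(u_1,\dots,u_n)$ on $U\subset M$ induce coordinates $(u_i,u_{i'})$ on $\pi^{-1}(U)$, $i'=n+i$, where $u_{i'}=\omega_i$ are the components of a covector $\omega$ with respect to $\{du^i\}$. Write $\partial_i=\partial/\partial u_i$, $\partial_{i'}=\partial/\partial\omega_i$, and $\nabla_{\partial_i}\partial_j=\sum_k\Gamma_{ij}^k\partial_k$. For a symmetric $(0,2)$-tensor field $\phi$ on $M$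 with components $\phi_{ij}$, the deformed Riemannian extension is the pseudo-Riemannian metric $g_{(\nabla,\phi)}=g_\nabla+\pi^*\phi$ of neutral signature $(n,n)$ on $T^*M$, where $g_\nabla$ is the Riemannian extension; it is given locally by $$g_{(\nabla,\phi)}(\partial_i,\partial_j)=\phi_{ij}(u)-2\sum_k u_{k'}\Gamma_{ij}^k,\quad g_{(\nabla,\phi)}(\partial_i,\partial_{j'})=\delta_i^j,\quad g_{(\nabla,\phi)}(\partial_{i'},\partial_{j'})=0.$$ Pseudo-Riemannian Szabó: a pseudo-Riemannian manifold $(N,g)$ with Levi-Civita connection $\nabla$ and curvature tensor $R$ is Szabó if the Szabó operators $\mathcal{S}(X)=(\nabla_XR)(\cdot,X)X$ have constant eigenvalues on the unit pseudo-sphere bundles $S^{\pm}(TN)=\{X\in TN: g(X,X)=\pm1\}$; it is nilpotent Szabó if moreover its Szabó operators are nilpotent. *)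

(* Defs.v *)
From HB Require Import structures.
From mathcomp Require Import all_boot all_order all_algebra.
From mathcomp Require Import all_classical all_reals all_analysis.
From mathcomp Require Import complex ring.

Set Implicit Arguments.
Unset Strict Implicit.
Unset Printing Implicit Defensive.

Import Order.TTheory GRing.Theory Num.Theory.
Import numFieldNormedType.Exports.

Local Open Scope classical_set_scope.
Local Open Scope ring_scope.

(** * Smooth functions on open subsets of [R^n] *)

Notation basis i := (delta_mx 0 i).

(* [f] is C^oo on the open set [U]: every iterated directional derivative of
   [f] is Frechet differentiable at every point of [U]. *)
Definition smooth_on (R : realType) (n : nat) (U : set 'rV[R]_n)
    (f : 'rV[R]_n -> R) : Prop :=
  forall (vs : seq 'rV[R]_n) (u : 'rV[R]_n), U u ->
    differentiable (foldr (fun v g => 'D_v g) f vs) u.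

Section SmoothFacts.
Context {R : realType}.

Lemma near_eq_differentiable (V W : normedModType R) (f g : V -> W) (x : V) :
  (\forall y \near x, f y = g y) -> differentiable f x -> differentiable g x.
Proof.
move=> fg df; apply/diff_locallyP.
have fgx : f x = g x by apply: (nbhs_singleton fg).
have E : g \o shift x = cst (g x) + 'd f x +o_ 0 id.
  apply/eqaddoP => e e0.
  have /eqaddoP /(_ e e0) H := diff_locally df.
  have fg0 : \forall h \near 0, f (h + x) = g (h + x).
    move: fg; rewrite (near_shift 0 x) /=; apply: filterS => h /=.
    by rewrite subr0.
  near=> h.
  have <- : (f \o shift x - (cst (f x) + 'd f x)) h =
            (g \o shift x - (cst (g x) + 'd f x)) h.
    by rewrite /= !fctE /= fgx; congr (_ - _); near: h.
  by near: h.
have D : 'd g x = 'd f x :> (V -> W) by exact: (diff_unique (diff_continuous df) E).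
by rewrite D; split => //; apply: diff_continuous.
Unshelve. all: by end_near. Qed.

Lemma differentiable_rV (n m : nat) (h : 'rV[R]_n -> 'rV[R]_m) (u : 'rV[R]_n) :
  (forall i, differentiable (fun v => h v 0 i) u) -> differentiable h u.
Proof.
move=> dh.
have -> : h = \sum_(i < m) (fun v => h v 0 i *: (basis i : 'rV[R]_m)).
  apply/funext => v; rewrite fct_sumE; apply/rowP => j.
  rewrite summxE (bigD1 j) //= !mxE !eqxx mulr1 big1 ?addr0 // => i ij.
  by rewrite !mxE eq_sym (negPf ij) andbF mulr0.
apply: differentiable_sum => i; apply: differentiableZl; exact: dh.
Qed.

Lemma derive_rV (n m : nat) (h : 'rV[R]_n -> 'rV[R]_m) (u v : 'rV[R]_n) :
  (forall i, differentiable (fun v => h v 0 i) u) ->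
  'd h u v = \row_i 'D_v (fun w => h w 0 i) u.
Proof.
move=> dh; have dhu := differentiable_rV dh.
rewrite -deriveE // derive_mx; first by apply/rowP => i; rewrite !mxE.
exact: diff_derivable.
Qed.

Lemma chain_rule (n m : nat) (f : 'rV[R]_m -> R) (h : 'rV[R]_n -> 'rV[R]_m)
    (u v : 'rV[R]_n) :
  differentiable f (h u) -> (forall i, differentiable (fun v => h v 0 i) u) ->
  'D_v (f \o h) u =
  \sum_k 'D_v (fun w => h w 0 k) u * 'D_(basis k) f (h u).
Proof.
move=> df dh; have dhu := differentiable_rV dh.
rewrite deriveE; last exact: differentiable_comp.
rewrite diff_comp //= derive_rV // [X in 'd f _ X]row_sum_delta linear_sum /=.
by apply: eq_bigr => k _; rewrite linearZ /= mxE -deriveE.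
Qed.

Lemma smooth_onS (n : nat) (U : set 'rV[R]_n) f v :
  smooth_on U f -> smooth_on U ('D_v f).
Proof. by move=> sf vs u Uu; have := sf (rcons vs v) u Uu; rewrite foldr_rcons. Qed.

Lemma smooth_on_diff (n : nat) (U : set 'rV[R]_n) f u :
  smooth_on U f -> U u -> differentiable f u.
Proof. by move=> sf; apply: (sf [::]). Qed.

Lemma smooth_sub (n : nat) (U U' : set 'rV[R]_n) f :
  U `<=` U' -> smooth_on U' f -> smooth_on U f.
Proof. by move=> UU' sf vs u /UU'; apply: sf. Qed.

Lemma smooth_coind (n : nat) (U : set 'rV[R]_n) (C : ('rV[R]_n -> R) -> Prop) :
  (forall f, C f -> forall u, U u -> differentiable f u) ->
  (forall f v, C f -> C ('D_v f)) ->
  forall f, C f -> smooth_on U f.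
Proof.
move=> dC DC f Cf vs; apply: dC; elim: vs => //= v vs; exact: DC.
Qed.

Inductive smooth_gen n (U : set 'rV[R]_n) : ('rV[R]_n -> R) -> Prop :=
| gen_smooth f : smooth_on U f -> smooth_gen U f
| gen_add f g : smooth_gen U f -> smooth_gen U g ->
    smooth_gen U (fun u => f u + g u)
| gen_mul f g : smooth_gen U f -> smooth_gen U g ->
    smooth_gen U (fun u => f u * g u)
| gen_comp m (U' : set 'rV[R]_m) f (h : 'rV[R]_n -> 'rV[R]_m) :
    (forall u, U u -> U' (h u)) -> smooth_on U' f ->
    (forall i, smooth_gen U (fun u => h u 0 i)) -> smooth_gen U (f \o h)
| gen_ext f g : (forall u, U u -> f u = g u) -> smooth_gen U f ->
    smooth_gen U g.

Lemma near_open n (U : set 'rV[R]_n) (f g : 'rV[R]_n -> R) u : open U ->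
  (forall u, U u -> f u = g u) -> U u -> \forall v \near u, f v = g v.
Proof.
move=> oU fg Uu; have : nbhs u U by exact: open_nbhs_nbhs.
by apply: filterS => v /fg.
Qed.

Lemma smooth_gen_diff n (U : set 'rV[R]_n) f u :
  open U -> smooth_gen U f -> U u -> differentiable f u.
Proof.
move=> oU gf; elim: gf u => {f}.
- move=> f sf u; exact: smooth_on_diff.
- by move=> f g _ df _ dg u Uu; apply: differentiableD; [exact: df|exact: dg].
- by move=> f g _ df _ dg u Uu; apply: differentiableM; [exact: df|exact: dg].
- move=> m U' f h hU sf _ dh u Uu; apply: differentiable_comp.
    by apply: differentiable_rV => i; exact: dh.
  by apply: smooth_on_diff sf _; exact: hU.
- move=> f g fg _ df u Uu; apply: near_eq_differentiable (df u Uu).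
  exact: near_open fg Uu.
Qed.

Lemma smooth_cst n (U : set 'rV[R]_n) c : smooth_on U (cst c).
Proof.
move=> vs u _; suff [d ->] : exists d, foldr (fun v g => 'D_v g) (cst c) vs = cst d.
  exact: differentiable_cst.
elim: vs => [|v vs [d IH]]; first by exists c.
by exists 0; rewrite /= IH; apply/funext => w; rewrite derive_cst.
Qed.

Lemma smooth_gen_sum n (U : set 'rV[R]_n) m (F : 'I_m -> 'rV[R]_n -> R) :
  (forall i, smooth_gen U (F i)) -> smooth_gen U (fun u => \sum_i F i u).
Proof.
elim: m F => [|m IH] F gF.
  apply: (gen_ext (f := cst 0)); last by apply: gen_smooth; exact: smooth_cst.
  by move=> u _; rewrite big_ord0.
apply: (gen_ext (f := fun u => F ord0 u + \sum_i F (lift ord0 i) u)).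
  by move=> u _; rewrite big_ord_recl.
by apply: gen_add => //; exact: IH.
Qed.

Lemma smooth_gen_derive n (U : set 'rV[R]_n) f v :
  open U -> smooth_gen U f -> smooth_gen U ('D_v f).
Proof.
move=> oU; elim=> {f}.
- by move=> f sf; apply: gen_smooth; exact: smooth_onS.
- move=> f g gf Df gg Dg; apply: gen_ext (gen_add Df Dg) => u Uu.
  by rewrite deriveD //; apply: diff_derivable; exact: smooth_gen_diff Uu.
- move=> f g gf Df gg Dg.
  apply: gen_ext (gen_add (gen_mul gf Dg) (gen_mul gg Df)) => u Uu.
  by rewrite deriveM //; apply: diff_derivable; exact: smooth_gen_diff Uu.
- move=> m U' f h hU sf gh Dh.
  apply: (gen_ext (f := fun u =>
      \sum_k 'D_v (fun w => h w 0 k) u * ('D_(basis k) f \o h) u)).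
    move=> u Uu; rewrite chain_rule //.
      by apply: smooth_on_diff sf _; exact: hU.
    by move=> i; exact: smooth_gen_diff Uu.
  apply: smooth_gen_sum => k; apply: gen_mul => //.
  by apply: (gen_comp hU) => //; exact: smooth_onS.
- move=> f g fg gf Df; apply: gen_ext Df => u Uu.
  by apply: near_eq_derive; exact: near_open fg Uu.
Qed.

Lemma smooth_genP n (U : set 'rV[R]_n) f :
  open U -> smooth_gen U f -> smooth_on U f.
Proof.
move=> oU; apply: smooth_coind => [g gg u|g v]; last exact: smooth_gen_derive.
exact: smooth_gen_diff.
Qed.

Lemma smooth_linear n (U : set 'rV[R]_n) (f : {linear 'rV[R]_n -> R}) :
  continuous f -> smooth_on U f.
Proof.
move=> cf vs u Uu.
have df w : differentiable f w by exact: linear_differentiable.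
have [-> //|[d ->]] : foldr (fun v g => 'D_v g) (f : 'rV[R]_n -> R) vs = f \/
    exists d, foldr (fun v g => 'D_v g) (f : 'rV[R]_n -> R) vs = cst d.
  elim: vs => [|v vs [IH|[d IH]]] /=; [by left|right|right]; rewrite IH.
    by exists (f v); apply/funext => w; rewrite deriveE // diff_lin.
  by exists 0; apply/funext => w; rewrite derive_cst.
exact: differentiable_cst.
Qed.

End SmoothFacts.

(** * Smooth manifolds *)

(* A smooth [n]-manifold is a set of points with an atlas of local
   parametrizations [param a : dom a -> point], inverted by [coord a].
   The manifold topology is the one that the charts induce.  It is
   second countable iff countably many charts cover the manifold. *)
Record manifold (R : realType) (n : nat) := Manifold {
  point :> Type;
  chart : Type;
  dom : chart -> set 'rV[R]_n;
  param : chart -> 'rV[R]_n -> point;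
  coord : chart -> point -> 'rV[R]_n;
  dom_open : forall a, open (dom a);
  paramK : forall a u, dom a u -> coord a (param a u) = u;
  overlap_open : forall a b,
    open [set u | dom a u /\ (param b @` dom b) (param a u)];
  transition_smooth : forall a b i,
    smooth_on [set u | dom a u /\ (param b @` dom b) (param a u)]
              (fun u => coord b (param a u) 0 i);
  countable_atlas : exists2 C : set chart, countable C &
    forall p, exists2 a, C a & (param a @` dom a) p;
  hausdorff : forall p q, p <> q ->
    exists (a b : chart) (A B : set 'rV[R]_n),
      [/\ open A /\ A `<=` dom a, open B /\ B `<=` dom b,
          (param a @` A) p, (param b @` B) q &
          param a @` A `&` param b @` B = set0]
}.

Arguments dom_open {R n} M a : rename.
Arguments transition_smooth {R n} M a b i : rename.
Arguments overlap_open {R n} M a b : rename.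
Arguments countable_atlas {R n} M : rename.

Definition patch (R : realType) (n : nat) (M : manifold R n) (a : chart M) :
  set M := param a @` dom a.

Definition overlap (R : realType) (n : nat) (M : manifold R n)
    (a b : chart M) : set 'rV[R]_n :=
  [set u | dom a u /\ patch b (param a u)].

Definition transition (R : realType) (n : nat) (M : manifold R n)
    (a b : chart M) (u : 'rV[R]_n) : 'rV[R]_n :=
  coord b (param a u).

(* The entry [(i, k)] is [d u_b^k / d u_a^i]. *)
Definition jac (R : realType) (n : nat) (M : manifold R n) (a b : chart M)
    (u : 'rV[R]_n) : 'M[R]_n :=
  \matrix_(i, k) 'D_(basis i) (fun v => transition a b v 0 k) u.

Section ManifoldFacts.
Context {R : realType} {n : nat} {M : manifold R n}.
Implicit Types (a b c : chart M) (p : M) (u : 'rV[R]_n).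

Lemma patch_coord a p : patch a p -> dom a (coord a p) /\ param a (coord a p) = p.
Proof. by case=> u du <-; rewrite paramK. Qed.

Lemma overlap_transition a b u : overlap a b u -> overlap b a (transition a b u).
Proof.
case=> du pu; have [d e] := patch_coord pu; split => //.
by rewrite /transition e; exists u.
Qed.

Lemma param_transition a b u : overlap a b u ->
  param b (transition a b u) = param a u.
Proof. by case=> _ /patch_coord []. Qed.

Lemma transitionK a b u : overlap a b u -> transition b a (transition a b u) = u.
Proof. by move=> o; rewrite {1}/transition param_transition // paramK //; case: o. Qed.

Lemma overlap_coord a b p : patch a p -> patch b p -> overlap a b (coord a p).
Proof. by move=> /patch_coord [d e] pb; split; rewrite ?e. Qed.

Lemma transition_coord a b p : patch a p -> transition a b (coord a p) = coord b p.
Proof. by move=> /patch_coord [d e]; rewrite /transition e. Qed.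

Lemma overlap_openE a b : open (overlap a b).
Proof. exact: overlap_open. Qed.

Lemma smooth_transition a b i :
  smooth_on (overlap a b) (fun u => transition a b u 0 i).
Proof. exact: transition_smooth. Qed.

Lemma smooth_jac a b i k : smooth_on (overlap a b) (fun u => jac a b u i k).
Proof.
rewrite (_ : (fun _ => _) = 'D_(basis i) (fun v => transition a b v 0 k)).
  by apply: smooth_onS; exact: smooth_transition.
by apply/funext => u; rewrite mxE.
Qed.

Lemma jac_id a u : dom a u -> jac a a u = 1%:M.
Proof.
move=> du; apply/matrixP => i k; rewrite !mxE.
rewrite (near_eq_derive (g := fun v : 'rV[R]_n => v 0 k)); last first.
  move: (open_nbhs_nbhs (conj (dom_open M a) du)); apply: filterS => v dv.
  by rewrite /transition paramK.
rewrite -(_ : (basis i : 'rV[R]_n) 0 k = (i == k)%:R); last by rewrite mxE eqxx eq_sym.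
rewrite -[in RHS](derive_id u (basis i)) derive_mx ?mxE //.
Qed.

Lemma jac_chain a b c u : overlap a b u -> overlap a c u ->
  jac a c u = jac a b u *m jac b c (transition a b u).
Proof.
move=> ab ac; apply/matrixP => i k; rewrite !mxE.
have bc : overlap b c (transition a b u).
  have [d e] := patch_coord ab.2; split => //.
  by rewrite param_transition //; case: ac.
rewrite (near_eq_derive
    (g := (fun w => transition b c w 0 k) \o transition a b)); last first.
  have oo : open (overlap a b) by exact: overlap_openE.
  move: (open_nbhs_nbhs (conj oo ab)); apply: filterS => v abv /=.
  by rewrite /transition -/(transition a b v) param_transition.
rewrite chain_rule.
- by apply: eq_bigr => j _; rewrite !mxE.
- exact: smooth_on_diff (smooth_transition k) bc.
- by move=> j; exact: smooth_on_diff (smooth_transition j) ab.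
Qed.

Lemma jacK a b u : overlap a b u -> jac a b u *m jac b a (transition a b u) = 1%:M.
Proof.
move=> ab; rewrite -jac_chain //; first by rewrite jac_id //; case: ab.
by have [d _] := ab; split => //; exists u.
Qed.

End ManifoldFacts.
Arguments smooth_transition {R n M} a b i.
Arguments smooth_jac {R n M} a b i k.
Arguments overlap_openE {R n M} a b.

(** * Affine connections and symmetric (0,2)-tensor fields *)

(* [G u i j k] is the symbol [Gamma_ij^k] at the point of coordinates [u]. *)
Definition christoffel (R : realType) (n : nat) :=
  'rV[R]_n -> 'I_n -> 'I_n -> 'I_n -> R.

(* A smooth torsion-free affine connection, given by its Christoffel symbols in
   every chart; the law expresses [nabla_(d_i) d_j] in another chart through
   [d_i = sum_p (jac a b u i p) d'_p]. *)
Record affine_connection (R : realType) (n : nat) (M : manifold R n) :=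
  AffineConnection {
  symbols :> chart M -> christoffel R n;
  symbols_smooth : forall a i j k,
    smooth_on (dom a) (fun u => symbols a u i j k);
  torsion_free : forall a u i j k, dom a u ->
    symbols a u i j k = symbols a u j i k;
  symbols_law : forall a b u, overlap a b u -> forall i j k,
    \sum_l symbols a u i j l * jac a b u l k =
    'D_(basis i) (fun v => jac a b v j k) u +
    \sum_p \sum_q jac a b u i p * jac a b u j q *
      symbols b (transition a b u) p q k
}.

Record sym_tensor2 (R : realType) (n : nat) (M : manifold R n) := SymTensor2 {
  comps :> chart M -> 'rV[R]_n -> 'M[R]_n;
  comps_smooth : forall a i j, smooth_on (dom a) (fun u => comps a u i j);
  comps_sym : forall a u, dom a u -> (comps a u)^T = comps a u;
  comps_law : forall a b u, overlap a b u ->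
    comps a u = jac a b u *m comps b (transition a b u) *m (jac a b u)^T
}.

(** * The cotangent bundle *)

(* A covector at a point is the family of its component vectors in all the
   charts around the point; the component in the other charts is set to 0. *)
Record covector (R : realType) (n : nat) (M : manifold R n) := Covector {
  base : M;
  covec : chart M -> 'rV[R]_n;
  covec_out : forall a, ~ patch a base -> covec a = 0;
  covec_law : forall a b, patch a base -> patch b base ->
    covec b = covec a *m (jac b a (coord b base))^T
}.

Section CotangentBundle.
Context {R : realType} {n : nat} (M : manifold R n).
Implicit Types (a b c : chart M) (p : M) (w : 'rV[R]_(n + n)).

Lemma covector_eq (P Q : covector M) : base P = base Q ->
  (forall a, patch a (base P) -> covec P a = covec Q a) -> P = Q.
Proof.
case: P Q => p v vo vl [q w wo wl] /= E; move: E wo wl => <- wo wl vw.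
have E : v = w.
  apply/funext => a; have [/vw //|np] := pselect (patch a p).
  by rewrite vo // wo.
by move: E wo wl => <- wo wl; congr Covector; exact: Prop_irrelevance.
Qed.

Definition cot_dom a : set 'rV[R]_(n + n) := [set w | dom a (lsubmx w)].

Definition cot_covec a w b : 'rV[R]_n :=
  if `[< dom a (lsubmx w) /\ patch b (param a (lsubmx w)) >]
  then rsubmx w *m (jac b a (transition a b (lsubmx w)))^T else 0.

Fact cot_covec_out a w b : ~ patch b (param a (lsubmx w)) -> cot_covec a w b = 0.
Proof. by move=> nb; rewrite /cot_covec; case: asboolP => // -[]. Qed.

Fact cot_covec_law a w b c :
  patch b (param a (lsubmx w)) -> patch c (param a (lsubmx w)) ->
  cot_covec a w c =
  cot_covec a w b *m (jac c b (coord c (param a (lsubmx w))))^T.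
Proof.
move=> pb pc; rewrite /cot_covec.
have [da|nda] := pselect (dom a (lsubmx w)); last first.
  by rewrite !asboolF ?mul0mx // => -[].
rewrite !asboolT // -mulmxA -trmx_mul; congr (_ *m _^T).
have pa : patch a (param a (lsubmx w)) by exists (lsubmx w).
rewrite -/(transition a c (lsubmx w)).
have cb : overlap c b (transition a c (lsubmx w)) by exact: overlap_coord.
have ca : overlap c a (transition a c (lsubmx w)) by exact: overlap_coord.
by rewrite (jac_chain cb ca); congr (_ *m jac _ _ _); rewrite transition_coord.
Qed.

Definition cot_param a w : covector M :=
  Covector (@cot_covec_out a w) (@cot_covec_law a w).

Definition cot_coord a (P : covector M) : 'rV[R]_(n + n) :=
  row_mx (coord a (base P)) (covec P a).

Fact cot_paramK a w : cot_dom a w -> cot_coord a (cot_param a w) = w.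
Proof.
rewrite /cot_dom /= => da; rewrite /cot_coord /= paramK //.
rewrite /cot_covec asboolT; last by split => //; exists (lsubmx w).
by rewrite {1}/transition paramK // jac_id // trmx1 mulmx1 hsubmxK.
Qed.

Lemma cot_coordK a (P : covector M) : patch a (base P) ->
  cot_dom a (cot_coord a P) /\ cot_param a (cot_coord a P) = P.
Proof.
move=> pa; have [d e] := patch_coord pa.
rewrite /cot_dom /= row_mxKl; split => //; apply: covector_eq => /=.
  by rewrite row_mxKl.
rewrite row_mxKl e => b pb.
rewrite /cot_covec row_mxKl row_mxKr e asboolT //.
by rewrite transition_coord // -covec_law.
Qed.

Lemma cot_patchP a (P : covector M) :
  (cot_param a @` cot_dom a) P <-> patch a (base P).
Proof.
split; last by move=> /cot_coordK [d e]; exists (cot_coord a P).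
by case=> w dw <-; exists (lsubmx w).
Qed.

Lemma cot_overlapE a b :
  [set w | cot_dom a w /\ (cot_param b @` cot_dom b) (cot_param a w)] =
  lsubmx @^-1` overlap a b.
Proof.
by apply/seteqP; split => w /= [dw pw]; split => //;
  apply/(cot_patchP b (cot_param a w)).
Qed.

Lemma open_lsubmx (U : set 'rV[R]_n) :
  open U -> open ((lsubmx : 'rV[R]_(n + n) -> 'rV[R]_n) @^-1` U).
Proof. by move=> oU; apply: open_comp => // w _; exact: continuous_lsubmx. Qed.

Fact cot_dom_open a : open (cot_dom a).
Proof. exact: (open_lsubmx (dom_open M a)). Qed.

Fact cot_overlap_open a b :
  open [set w | cot_dom a w /\ (cot_param b @` cot_dom b) (cot_param a w)].
Proof. by rewrite cot_overlapE; apply: open_lsubmx; exact: overlap_openE. Qed.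

Lemma smooth_coord (U : set 'rV[R]_(n + n)) i : smooth_on U (fun w => w 0 i).
Proof.
have @f : {linear 'rV[R]_(n + n) -> R}.
  by exists (fun w => w 0 i); do 2![eexists]; do ?[constructor];
     rewrite ?mxE// => ? *; rewrite ?mxE//; move=> ?; rewrite !mxE.
by apply: (smooth_linear (f := f)); exact: coord_continuous.
Qed.

Lemma smooth_lsubmx (U : set 'rV[R]_(n + n)) i :
  smooth_on U (fun w => lsubmx w 0 i).
Proof.
rewrite (_ : (fun _ => _) = fun w => w 0 (lshift n i)); first exact: smooth_coord.
by apply/funext => w; rewrite mxE.
Qed.

Lemma smooth_rsubmx (U : set 'rV[R]_(n + n)) i :
  smooth_on U (fun w => rsubmx w 0 i).
Proof.
rewrite (_ : (fun _ => _) = fun w => w 0 (rshift n i)); first exact: smooth_coord.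
by apply/funext => w; rewrite mxE.
Qed.

Lemma smooth_pullback (U : set 'rV[R]_n) f :
  open U -> smooth_on U f ->
  smooth_on (lsubmx @^-1` U) (fun w : 'rV[R]_(n + n) => f (lsubmx w)).
Proof.
move=> oU sf; apply: smooth_genP; first exact: open_lsubmx.
apply: (@gen_comp _ _ _ _ U f lsubmx) => // i.
by apply: gen_smooth; exact: smooth_lsubmx.
Qed.

Fact cot_transition_smooth a b i :
  smooth_on [set w | cot_dom a w /\ (cot_param b @` cot_dom b) (cot_param a w)]
            (fun w => cot_coord b (cot_param a w) 0 i).
Proof.
rewrite cot_overlapE.
have oo : open (overlap a b) by exact: overlap_openE.
have oU := open_lsubmx oo.
case: (split_ordP i) => k ->.
  rewrite (_ : (fun _ => _) = fun w => transition a b (lsubmx w) 0 k).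
    exact: smooth_pullback (smooth_transition a b k).
  by apply/funext => w; rewrite /cot_coord row_mxEl.
apply: smooth_genP => //.
apply: (gen_ext (f := fun w =>
    \sum_j rsubmx w 0 j * jac b a (transition a b (lsubmx w)) k j)).
  move=> w /= [dw pw]; rewrite /cot_coord row_mxEr /= /cot_covec asboolT //.
  by rewrite [RHS]mxE; apply: eq_bigr => j _; rewrite [(_^T) _ _]mxE.
apply: smooth_gen_sum => j; apply: gen_mul.
  by apply: gen_smooth; exact: smooth_rsubmx.
apply: gen_smooth.
apply: (smooth_pullback (f := fun u => jac b a (transition a b u) k j)) => //.
apply: smooth_genP => //.
apply: (@gen_comp _ _ _ _ (overlap b a) (fun v => jac b a v k j)) => [u||l].
- exact: overlap_transition.
- exact: smooth_jac.
- by apply: gen_smooth; exact: smooth_transition.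
Qed.

Fact cot_countable_atlas : exists2 C : set (chart M), countable C &
  forall P, exists2 a, C a & (cot_param a @` cot_dom a) P.
Proof.
have [C cC HC] := countable_atlas M; exists C => // P.
by have [a Ca Pa] := HC (base P); exists a => //; apply/cot_patchP.
Qed.

Fact cot_hausdorff (P Q : covector M) : P <> Q ->
  exists (a b : chart M) (A B : set 'rV[R]_(n + n)),
      [/\ open A /\ A `<=` cot_dom a, open B /\ B `<=` cot_dom b,
          (cot_param a @` A) P, (cot_param b @` B) Q &
          cot_param a @` A `&` cot_param b @` B = set0].
Proof.
move=> PQ; have [E|/hausdorff] := pselect (base P = base Q).
  have [a pa] : exists a, patch a (base P).
    by have [C _ /(_ (base P)) [a _ pa]] := countable_atlas M; exists a.
  have [dP eP] := cot_coordK pa.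
  have [dQ eQ] : cot_dom a (cot_coord a Q) /\ cot_param a (cot_coord a Q) = Q.
    by apply: cot_coordK; rewrite -E.
  have ne : cot_coord a P != cot_coord a Q.
    by apply/eqP => e; apply: PQ; rewrite -eP -eQ e.
  have := @norm_hausdorff R 'rV[R]_(n + n); rewrite open_hausdorff.
  move=> /(_ _ _ ne) [[A B] /= [pA qB] [oA oB /eqP AB]].
  exists a, a, (A `&` cot_dom a), (B `&` cot_dom a); split.
  - by split; [apply: openI => //; exact: cot_dom_open|exact: subIsetr].
  - by split; [apply: openI => //; exact: cot_dom_open|exact: subIsetr].
  - by exists (cot_coord a P) => //; split => //; rewrite inE in pA.
  - by exists (cot_coord a Q) => //; split => //; rewrite inE in qB.
  - apply/seteqP; split => // _ [[w [Aw dw] <-] [w' [Bw' dw'] e]].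
    have ww : w' = w by rewrite -(cot_paramK dw') e cot_paramK.
    have : (A `&` B) w by split => //; rewrite -ww.
    by rewrite AB.
case=> a [b [A [B [[oA Aa] [oB Bb] Ap Bq AB]]]].
exists a, b, (lsubmx @^-1` A), (lsubmx @^-1` B); split.
- by split; [exact: open_lsubmx|move=> w /Aa].
- by split; [exact: open_lsubmx|move=> w /Bb].
- case: Ap => u Au e.
  have pa : patch a (base P) by exists u => //; exact: Aa.
  have [dP eP] := cot_coordK pa; exists (cot_coord a P) => //=.
  by rewrite row_mxKl -e paramK //; exact: Aa.
- case: Bq => u Bu e.
  have pb : patch b (base Q) by exists u => //; exact: Bb.
  have [dQ eQ] := cot_coordK pb; exists (cot_coord b Q) => //=.
  by rewrite row_mxKl -e paramK //; exact: Bb.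
- apply/seteqP; split => // _ [[w Aw <-] [w' Bw' e]].
  have : (param a @` A `&` param b @` B) (param a (lsubmx w)).
    by split; [exists (lsubmx w)|exists (lsubmx w') => //; exact: (congr1 (@base _ _ _) e)].
  by rewrite AB.
Qed.

Definition cotangent_bundle : manifold R (n + n) :=
  Manifold cot_dom_open cot_paramK cot_overlap_open cot_transition_smooth
    cot_countable_atlas cot_hausdorff.

End CotangentBundle.

(** * The deformed Riemannian extension *)

Section DeformedRiemannianExtension.
Context {R : realType} {n : nat} {M : manifold R n}.
Variables (D : affine_connection M) (phi : sym_tensor2 M).
Implicit Types (a b : chart M) (w : 'rV[R]_(n + n)).

Definition dre_horizontal a w : 'M[R]_n :=
  \matrix_(i, j) (phi a (lsubmx w) i j -
                  2 * \sum_k rsubmx w 0 k * D a (lsubmx w) i j k).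

(* The coordinates [w = row_mx u omega] of a covector are its base point [u]
   and its components [omega]. *)
Definition dre_comps (a : chart (cotangent_bundle M)) w : 'M[R]_(n + n) :=
  block_mx (dre_horizontal a w) 1%:M 1%:M 0.

Fact dre_smooth (a : chart (cotangent_bundle M)) i j :
  smooth_on (dom a) (fun w => dre_comps a w i j).
Proof.
have oU := open_lsubmx (dom_open M a).
case: (split_ordP i) => {}i ->; case: (split_ordP j) => {}j ->.
- apply: smooth_genP => //.
  apply: (gen_ext (f := fun w => phi a (lsubmx w) i j +
     (cst (- 2) w : R) * \sum_k rsubmx w 0 k * D a (lsubmx w) i j k)).
    by move=> w _; rewrite /dre_comps block_mxEul mxE /= mulNr.
  have oa := dom_open M a.
  apply: gen_add.
    apply: gen_smooth.
    apply: (smooth_pullback (f := fun u => phi a u i j)) => //.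
    exact: comps_smooth.
  apply: gen_mul; first by apply: gen_smooth; exact: smooth_cst.
  apply: smooth_gen_sum => k; apply: gen_mul; apply: gen_smooth.
    exact: smooth_rsubmx.
  apply: (smooth_pullback (f := fun u => D a u i j k)) => //.
  exact: symbols_smooth.
- rewrite (_ : (fun _ => _) = cst (1%:M i j)); first exact: smooth_cst.
  by apply/funext => w; rewrite /dre_comps block_mxEur.
- rewrite (_ : (fun _ => _) = cst (1%:M i j)); first exact: smooth_cst.
  by apply/funext => w; rewrite /dre_comps block_mxEdl.
- rewrite (_ : (fun _ => _) = cst 0); first exact: smooth_cst.
  by apply/funext => w; rewrite /dre_comps block_mxEdr mxE.
Qed.

Fact dre_sym (a : chart (cotangent_bundle M)) w :
  dom a w -> (dre_comps a w)^T = dre_comps a w.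
Proof.
move=> dw; rewrite /dre_comps tr_block_mx trmx1 trmx0; congr block_mx.
apply/matrixP => i j; rewrite !mxE; congr (_ - 2 * _).
  by rewrite -[in RHS](comps_sym phi dw) mxE.
by apply: eq_bigr => k _; rewrite (torsion_free D _ _ _ dw).
Qed.

Lemma derive_lsubmx (f : 'rV[R]_n -> R) w (x : 'rV[R]_(n + n)) :
  'D_x (fun v => f (lsubmx v)) w = 'D_(lsubmx x) f (lsubmx w).
Proof.
have E (h : R) : lsubmx (h *: x + w) = h *: lsubmx x + lsubmx w.
  by apply/rowP => i; rewrite !mxE.
rewrite /derive /=; set A := (fun h : R => _); set B := (X in _ = lim (fmap X _)).
by have -> : A = B by apply/funext => h; rewrite /A /B E.
Qed.

(* The derivative, along a tangent vector [x] of the cotangent bundle, of the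
   relation [omega_j = sum_k omega'_k d u'^k / d u^j]. *)
Lemma derive_fiber (a b : chart (cotangent_bundle M)) w x j :
  overlap a b w ->
  rsubmx x 0 j =
  \sum_k ('D_x (fun v => transition a b v 0 (rshift n k)) w *
            @jac _ _ M a b (lsubmx w) j k +
          transition a b w 0 (rshift n k) *
            'D_(lsubmx x) (fun u => @jac _ _ M a b u j k) (lsubmx w)).
Proof.
move=> ow; pose T k (v : 'rV[R]_(n + n)) : R := transition a b v 0 (rshift n k).
pose J k (v : 'rV[R]_(n + n)) : R := @jac _ _ M a b (lsubmx v) j k.
have ol : @overlap _ _ M a b (lsubmx w) by move: ow; rewrite /overlap /patch cot_overlapE.
have dT k : derivable (T k) w x.
  apply: diff_derivable.
  exact: (smooth_on_diff (smooth_transition a b (rshift n k)) ow).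
have dJ k : derivable (J k) w x.
  apply: diff_derivable.
  have H : smooth_on (lsubmx @^-1` @overlap _ _ M a b) (J k).
    apply: (smooth_pullback (f := fun u => @jac _ _ M a b u j k)).
      exact: overlap_openE.
    exact: smooth_jac.
  exact: (smooth_on_diff H ol).
have -> : rsubmx x 0 j = 'D_x (fun v : 'rV[R]_(n + n) => rsubmx v 0 j) w.
  rewrite (_ : (fun _ => _) = fun v : 'rV_(n + n) => v 0 (rshift n j)); last first.
    by apply/funext => v; rewrite mxE.
  by rewrite -[in LHS](derive_id w x) derive_mx ?mxE.
rewrite (near_eq_derive (g := \sum_k (T k * J k))); last first.
  move: (open_nbhs_nbhs (conj (overlap_openE a b) ow)); apply: filterS => v ov.
  have [dv pv] : @overlap _ _ M a b (lsubmx v).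
    by move: ov; rewrite /overlap /patch cot_overlapE.
  rewrite fct_sumE /= /T /J.
  transitivity ((rsubmx (transition a b v) *m (@jac _ _ M a b (lsubmx v))^T) 0 j).
    rewrite /transition /= /cot_coord row_mxKr /= /cot_covec asboolT //.
    by rewrite -mulmxA -trmx_mul jacK // trmx1 mulmx1.
  by rewrite [LHS]mxE; apply: eq_bigr => k _; rewrite [rsubmx _ _ _]mxE [(_^T) _ _]mxE.
rewrite derive_sum; last by move=> k; exact: derivableM.
apply: eq_bigr => k _.
have dJE : 'D_x (J k) w =
    'D_(lsubmx x) (fun u => @jac _ _ M a b u j k) (lsubmx w) :> R.
  exact: (derive_lsubmx (fun u => @jac _ _ M a b u j k)).
have := deriveM (dT k) (dJ k); rewrite dJE => ->.
by rewrite [LHS]addrC; congr (_ + _); exact: mulrC.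
Qed.

Fact dre_law (a b : chart (cotangent_bundle M)) w : overlap a b w ->
  dre_comps a w =
  jac a b w *m dre_comps b (transition a b w) *m (jac a b w)^T.
Proof.
move=> ow.
have ol : @overlap _ _ M a b (lsubmx w).
  by move: ow; rewrite /overlap /patch cot_overlapE.
set u := lsubmx w in ol *; set J := @jac _ _ M a b u.
set T := transition a b w.
have Tl : lsubmx T = @transition _ _ M a b u by rewrite /T /transition /= row_mxKl.
pose H : 'M[R]_n := ursubmx (jac a b w); pose L : 'M[R]_n := drsubmx (jac a b w).
have Hl k x : 'D_x (fun v => transition a b v 0 (lshift n k)) w =
    'D_(lsubmx x) (fun v => @transition _ _ M a b v 0 k) u :> R.
  rewrite -derive_lsubmx; congr ('D_x _ w); apply/funext => v.
  by rewrite /transition /= row_mxEl.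
have ll i : lsubmx (basis (lshift n i) : 'rV[R]_(n + n)) = basis i.
  by apply/rowP => k; rewrite !mxE eq_lshift.
have lr i : lsubmx (basis (rshift n i) : 'rV[R]_(n + n)) = 0.
  by apply/rowP => k; rewrite !mxE eq_lrshift andbF.
have rl i : rsubmx (basis (lshift n i) : 'rV[R]_(n + n)) = 0.
  by apply/rowP => k; rewrite !mxE eq_rlshift andbF.
have rr i : rsubmx (basis (rshift n i) : 'rV[R]_(n + n)) = basis i.
  by apply/rowP => k; rewrite !mxE eq_rshift.
have JE : jac a b w = block_mx J H 0 L.
  rewrite -[LHS]submxK; congr block_mx; apply/matrixP => i k.
    by rewrite [LHS]mxE [LHS]mxE [LHS]mxE Hl // ll mxE.
  by rewrite [LHS]mxE [LHS]mxE [LHS]mxE Hl // lr derive0 mxE.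
have HE i k : H i k = 'D_(basis (lshift n i))
    (fun v => transition a b v 0 (rshift n k)) w by rewrite !mxE.
have LE i k : L i k = 'D_(basis (rshift n i))
    (fun v => transition a b v 0 (rshift n k)) w by rewrite !mxE.
have e1 : L *m J^T = 1%:M.
  apply/matrixP => i j; rewrite mxE.
  have := derive_fiber (basis (rshift n i)) j ow; rewrite rr lr mxE /= => E.
  rewrite [RHS]mxE eq_sym E; apply: eq_bigr => k _.
  by rewrite derive0 mulr0 addr0 LE [(_^T) _ _]mxE.
pose Q : 'M[R]_n := \matrix_(i, j) \sum_k rsubmx w 0 k * D a u i j k.
pose Q' : 'M[R]_n :=
  \matrix_(i, j) \sum_k rsubmx T 0 k * D b (lsubmx T) i j k.
pose om k := T 0 (rshift n k).
have omE k : rsubmx T 0 k = om k by rewrite mxE.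
have wE l : rsubmx w 0 l = \sum_k om k * J l k.
  transitivity ((rsubmx T *m J^T) 0 l).
    have [dw pw] := ol.
    rewrite /T /transition /= /cot_coord row_mxKr /= /cot_covec asboolT //.
    by rewrite -mulmxA -trmx_mul jacK // trmx1 mulmx1.
  by rewrite [LHS]mxE; apply: eq_bigr => k _; rewrite omE [(_^T) _ _]mxE.
have QE : Q = J *m Q' *m J^T - H *m J^T.
  apply/matrixP => i j.
  have HJ : (H *m J^T) i j = - \sum_k om k *
      'D_(basis i) (fun u => @jac _ _ M a b u j k) u.
    have := derive_fiber (basis (lshift n i)) j ow.
    rewrite rl ll mxE big_split /= => /esym/eqP.
    rewrite addr_eq0 => /eqP <-; rewrite [LHS]mxE.
    by apply: eq_bigr => k _; rewrite HE [(_^T) _ _]mxE.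
  have QJ : (J *m Q' *m J^T) i j =
      \sum_k om k * \sum_p \sum_q J i p * J j q * D b (lsubmx T) p q k.
    transitivity (\sum_q \sum_p \sum_k
        om k * (J i p * J j q * D b (lsubmx T) p q k)).
      rewrite [LHS]mxE; apply: eq_bigr => q _.
      rewrite [X in X * _]mxE [(_^T) _ _]mxE mulr_suml.
      apply: eq_bigr => p _; rewrite [Q' _ _]mxE mulr_sumr mulr_suml.
      by apply: eq_bigr => k _; rewrite omE; ring.
    rewrite exchange_big /=; under eq_bigr do rewrite exchange_big /=.
    rewrite exchange_big /=; apply: eq_bigr => k _.
    by rewrite mulr_sumr; apply: eq_bigr => p _; rewrite mulr_sumr.
  rewrite [RHS]mxE [X in _ + X]mxE HJ QJ opprK -big_split /=.
  transitivity (\sum_k om k * \sum_l D a u i j l * J l k).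
    rewrite [LHS]mxE; under eq_bigr do rewrite wE mulr_suml.
    rewrite exchange_big /=; apply: eq_bigr => k _; rewrite mulr_sumr.
    by apply: eq_bigr => l _; rewrite -mulrA; congr (_ * _); rewrite mulrC.
  apply: eq_bigr => k _; rewrite -mulrDr; congr (_ * _).
  by rewrite (symbols_law D ol) Tl addrC.
have GE : dre_horizontal a w = phi a u - 2 *: Q.
  by apply/matrixP => i j; rewrite !mxE.
have G'E : dre_horizontal b T = phi b (lsubmx T) - 2 *: Q'.
  by apply/matrixP => i j; rewrite !mxE.
have Qs : Q^T = Q.
  apply/matrixP => i j; rewrite !mxE; apply: eq_bigr => k _.
  by rewrite (torsion_free D _ _ _ (_ : dom (m := M) a u)) //; case: ol.
have Q's : Q'^T = Q'.
  apply/matrixP => i j; rewrite !mxE; apply: eq_bigr => k _.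
  rewrite (torsion_free D _ _ _ (_ : dom (m := M) b (lsubmx T))) // Tl.
  by case: (overlap_transition ol).
have As : (H *m J^T)^T = H *m J^T.
  have -> : H *m J^T = J *m Q' *m J^T - Q by rewrite QE subKr.
  by rewrite linearB /= Qs !trmx_mul trmxK Q's mulmxA.
rewrite JE /dre_comps tr_block_mx trmx0 !mulmx_block.
rewrite !(mul0mx, mulmx0, mulmx1, mul1mx, add0r, addr0).
congr block_mx.
- rewrite GE G'E QE Tl mulmxBr !mulmxDl mulNmx (comps_law phi ol) -/J.
  rewrite -[J *m H^T]trmxK trmx_mul trmxK As.
  rewrite -scalemxAr -scalemxAl.
  move: (J *m Q' *m _) (H *m _) (J *m _ *m _) => X Y Z.
  by apply/matrixP => i j; rewrite !mxE; ring.
- by rewrite -[J]trmxK -trmx_mul e1 trmx1.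
- by rewrite e1.
Qed.

Definition deformed_riemannian_extension : sym_tensor2 (cotangent_bundle M) :=
  SymTensor2 dre_smooth dre_sym dre_law.

End DeformedRiemannianExtension.

(** * Curvature and Szabo operators in coordinates *)

Definition vector_field (R : realType) (n : nat) := 'rV[R]_n -> 'rV[R]_n.

Definition nabla (R : realType) (n : nat) (G : christoffel R n)
    (X Y : vector_field R n) : vector_field R n := fun u =>
  \row_k ('D_(X u) (fun v => Y v 0 k) u +
          \sum_i \sum_j X u 0 i * Y u 0 j * G u i j k).

Definition lie_bracket (R : realType) (n : nat) (X Y : vector_field R n) :
    vector_field R n := fun u =>
  \row_k ('D_(X u) (fun v => Y v 0 k) u - 'D_(Y u) (fun v => X v 0 k) u).

Definition curvature (R : realType) (n : nat) (G : christoffel R n)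
    (X Y Z : vector_field R n) : vector_field R n :=
  nabla G X (nabla G Y Z) - nabla G Y (nabla G X Z) -
  nabla G (lie_bracket X Y) Z.

Definition nabla_curvature (R : realType) (n : nat) (G : christoffel R n)
    (W X Y Z : vector_field R n) : vector_field R n :=
  nabla G W (curvature G X Y Z) - curvature G (nabla G W X) Y Z -
  curvature G X (nabla G W Y) Z - curvature G X Y (nabla G W Z).

(* The matrix, acting on row vectors on the right, of the Szabo operator
   [Y |-> (nabla_X R)(Y, X) X] at the point of coordinates [u], for
   [X = x^i d_i].  The right-hand side is tensorial, so [X] and [Y] may be
   extended by vector fields with constant components. *)
Definition szabo_operator (R : realType) (n : nat) (G : christoffel R n)
    (u x : 'rV[R]_n) : 'M[R]_n :=
  lin1_mx (fun y : 'rV[R]_n =>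
    nabla_curvature G (cst x) (cst y) (cst x) (cst x) u).

Definition affine_szabo_at (R : realType) (n : nat) (M : manifold R n)
    (D : affine_connection M) (p : M) : Prop :=
  forall (a : chart M), patch a p -> forall x y : 'rV[R]_n,
    char_poly (szabo_operator (D a) (coord a p) x) =
    char_poly (szabo_operator (D a) (coord a p) y).

Definition affine_szabo (R : realType) (n : nat) (M : manifold R n)
    (D : affine_connection M) : Prop :=
  forall p : M, affine_szabo_at D p.

(** * Pseudo-Riemannian metrics *)

(* [g] is nondegenerate of signature [(p, q)] at every point. *)
Definition pseudo_riemannian (R : realType) (p q : nat)
    (N : manifold R (p + q)) (g : sym_tensor2 N) : Prop :=
  forall (a : chart N) (u : 'rV[R]_(p + q)), dom a u ->
    exists2 P : 'M[R]_(p + q), P \in unitmx &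
      P *m g a u *m P^T = block_mx 1%:M 0 0 (- 1%:M).

Arguments pseudo_riemannian {R} p q {N} g.

Definition levi_civita (R : realType) (n : nat) (g : 'rV[R]_n -> 'M[R]_n) :
    christoffel R n := fun u i j k =>
  2^-1 * \sum_l invmx (g u) k l *
    ('D_(basis i) (fun v => g v j l) u + 'D_(basis j) (fun v => g v i l) u -
     'D_(basis l) (fun v => g v i j) u).

Definition pseudo_norm (R : realType) (n : nat) (g : 'M[R]_n)
    (x : 'rV[R]_n) : R := (x *m g *m x^T) 0 0.

(* Algebraic multiplicity of the complex number [lambda] as an eigenvalue
   of the real matrix [S] (0 if it is not an eigenvalue). *)
Definition eigen_mult (R : realType) (n : nat) (S : 'M[R]_n) (lambda : R[i]) :
    nat := mup lambda (char_poly (map_mx (real_complex R) S)).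

(* Constancy over the unit pseudo-sphere bundle of each sign, that is, between
   any two unit tangent vectors of that sign, at possibly distinct points. *)
Definition szabo (R : realType) (n : nat) (N : manifold R n)
    (g : sym_tensor2 N) : Prop :=
  forall epsilon : R, epsilon = 1 \/ epsilon = - 1 ->
  forall (a b : chart N) (u v x y : 'rV[R]_n), dom a u -> dom b v ->
    pseudo_norm (g a u) x = epsilon -> pseudo_norm (g b v) y = epsilon ->
    forall lambda : R[i],
      eigen_mult (szabo_operator (levi_civita (g a)) u x) lambda =
      eigen_mult (szabo_operator (levi_civita (g b)) v y) lambda.

Definition nilpotent_szabo (R : realType) (n : nat) (N : manifold R n)
    (g : sym_tensor2 N) : Prop :=
  szabo g /\
  forall (a : chart N) (u x : 'rV[R]_n), dom a u ->
    exists k : nat, szabo_operator (levi_civita (g a)) u x ^+ k = 0.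

(* Main.v *)
From HB Require Import structures.
Require Import Defs.
From mathcomp Require Import all_boot all_order all_algebra.
From mathcomp Require Import all_classical all_reals all_analysis.
From mathcomp Require Import complex ring.

(** Write a covector as a pair (u, omega) of a base point and fibre
    coordinates, and split its tangent space into the vertical vectors (0, alpha),
    which are covectors themselves, and a quotient, the tangent space of M.

    The Levi-Civita connection of the deformed Riemannian extension covers the
    affine connection: the base component of its symbols applied to X and Y is
    Gamma applied to the base components of X and Y.  So its curvature and its
    Szabo operators cover those of M, and S~(X) preserves the vertical vectors and
    induces S(x) on the quotient, where x is the base component of X.  On
    vertical vectors the connection is dual to the affine one, and its symbols
    are affine functions of omega whose slope is made of Gamma and its first
    derivatives ([gam_riem_ext]).  Differentiating along the fibre therefore gives
    R~(alpha, Y) Z = alpha o R(-, z) y ([curv_LC_fiber]), and, since both lower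
    arguments become x, S~(X) alpha = alpha o S(x) ([szabo_LC_fiber]).  Thus S~(X) is
    block triangular with diagonal blocks S(x) and S(x)^T
    ([szabo_operator_riem_ext]), and its characteristic polynomial is the square
    of that of S(x).

    The equivalence is then linear algebra.  As S(0) = 0, the connection is affine
    Szabo exactly when every S(x) has characteristic polynomial 'X^n, that is,
    when every S(x) is nilpotent, and by the square formula exactly when every
    S~(X) is nilpotent.  Nilpotent operators all have the same eigenvalues, so the
    constancy over unit vectors comes for free.  The metric has neutral signature
    because the vertical vectors form an isotropic subspace of half dimension
    ([neutral_block]).

    The Szabo operator is given through covariant derivatives of vector fields,
    some of them, such as nabla_X X, with non-constant components.  It becomes
    computable through the tensoriality of the curvature ([curvatureE]), which
    rests on the symmetry of second derivatives ([derive_comm]). *)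

Set Implicit Arguments.
Unset Strict Implicit.
Unset Printing Implicit Defensive.

Import Order.TTheory GRing.Theory Num.Theory.
Import numFieldNormedType.Exports.

Local Open Scope classical_set_scope.
Local Open Scope ring_scope.

Local Notation basis i := (delta_mx 0 i).

(** * Symmetry of second derivatives *)

Section SecondDerivatives.
Context {R : realType} {n : nat}.
Implicit Types (f : 'rV[R]_n -> R) (u v w : 'rV[R]_n).

Lemma is_derive_line f u v (s : R) : differentiable f (s *: v + u) ->
  is_derive s 1 (fun r => f (r *: v + u)) ('D_v f (s *: v + u)).
Proof.
move=> df.
have E : (fun h : R => h^-1 *: (((fun r => f (r *: v + u)) \o shift s) (h *: 1) -
                        f (s *: v + u))) =
         (fun h : R => h^-1 *: ((f \o shift (s *: v + u)) (h *: v) - f (s *: v + u))).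
  apply/funext => h /=; congr (_ *: (f _ - _)).
  by rewrite [h *: 1]mulr1 scalerDl addrA.
have dv : derivable f (s *: v + u) v by exact: diff_derivable.
apply: DeriveDef; first by rewrite /derivable E.
by rewrite /derive E.
Qed.

Lemma MVT_line f u v (t : R) : 0 < t ->
  (forall s, 0 <= s <= t -> differentiable f (s *: v + u)) ->
  exists2 s, 0 <= s <= t & f (t *: v + u) - f u = t * 'D_v f (s *: v + u).
Proof.
move=> t0 df.
have [||s st E] := @MVT R (fun r => f (r *: v + u))
   (fun s => 'D_v f (s *: v + u)) 0 t t0.
- move=> s; rewrite in_itv /= => /andP[s0 st].
  by apply: is_derive_line; apply: df; rewrite !ltW.
- apply: derivable_within_continuous => s; rewrite in_itv /= => st.
  by have [] := is_derive_line (df _ st).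
exists s; first by move: st; rewrite in_itv /= => /andP[a b]; rewrite !ltW.
by move: E; rewrite scale0r add0r subr0 mulrC.
Qed.

(** The mean value theorem, applied along v to the difference of [f] under a
    step t *: w and then along w to the derivative along v.  The left-hand side
    is symmetric in v and w, the right-hand side is not. *)
Lemma mixed_difference (U : set 'rV[R]_n) f u v w (t : R) : open U ->
  smooth_on U f -> 0 < t ->
  (forall s r, 0 <= s <= t -> 0 <= r <= t -> U (s *: v + (r *: w + u))) ->
  exists s r, [/\ 0 <= s <= t, 0 <= r <= t &
    f (t *: v + (t *: w + u)) - f (t *: v + u) - (f (t *: w + u) - f u) =
    t * (t * 'D_w ('D_v f) (s *: v + (r *: w + u)))].
Proof.
move=> oU sf t0 tU.
have tt : 0 <= t <= t by rewrite lexx ltW.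
have z0 : 0 <= (0 : R) <= t by rewrite lexx ltW.
pose g x := f (t *: w + x) - f x.
have shiftD (h : 'rV[R]_n -> R) (a x y : 'rV[R]_n) :
    'D_y (fun z => h (a + z)) x = 'D_y h (a + x).
  rewrite /derive /=; set A := (fun k : R => _); set B := (X in _ = lim (fmap X _)).
  by have -> : A = B by apply/funext => k; rewrite /A /B addrCA.
have dshift (h : 'rV[R]_n -> R) (a x : 'rV[R]_n) : differentiable h (a + x) ->
    differentiable (fun z => h (a + z)) x.
  move=> dh; apply: (differentiable_comp (f := +%R _) (g := h)) => //.
have df s r : 0 <= s <= t -> 0 <= r <= t -> differentiable f (s *: v + (r *: w + u)).
  by move=> hs hr; apply: smooth_on_diff sf _; exact: tU.
have df0 s : 0 <= s <= t -> differentiable f (s *: v + u).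
  by move=> hs; have := df s 0 hs z0; rewrite scale0r add0r.
have dg s : 0 <= s <= t -> differentiable g (s *: v + u).
  move=> hs; apply: differentiableB; last exact: df0.
  by apply: dshift; rewrite addrCA; exact: df.
have [s hs Es] := MVT_line t0 dg.
have Dg : 'D_v g (s *: v + u) =
    'D_v f (t *: w + (s *: v + u)) - 'D_v f (s *: v + u).
  rewrite deriveB ?shiftD //; apply: diff_derivable; last exact: df0.
  by apply: dshift; rewrite addrCA; exact: df.
have [r hr Er] : exists2 r, 0 <= r <= t &
    'D_v f (t *: w + (s *: v + u)) - 'D_v f (s *: v + u) =
    t * 'D_w ('D_v f) (r *: w + (s *: v + u)).
  apply: (MVT_line (f := 'D_v f) (u := s *: v + u) (v := w) t0) => r hr.
  rewrite addrCA; by apply: smooth_on_diff (smooth_onS v sf) _; exact: tU.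
exists s, r; split => //.
by rewrite [t *: v + (t *: w + u)]addrCA [s *: v + _]addrCA -Er -Dg -Es.
Qed.

(** Near u the second difference is at once t^2 times a value of D_w D_v f and
    t^2 times a value of D_v D_w f; by continuity both values tend to those
    at u. *)
Lemma derive_comm (U : set 'rV[R]_n) f u v w : open U -> smooth_on U f -> U u ->
  'D_v ('D_w f) u = 'D_w ('D_v f) u.
Proof.
move=> oU sf Uu; apply/eqP; rewrite -subr_eq0; apply/eqP.
have cvw a b : {for u, continuous ('D_a ('D_b f))}.
  apply: differentiable_continuous.
  exact: smooth_on_diff (smooth_onS a (smooth_onS b sf)) Uu.
apply/eqP; rewrite -normr_le0; apply/ler_addgt0Pr => e e0; rewrite add0r.
have e2 : 0 < e / 2 by rewrite divr_gt0.
have /cvgrPdist_le /(_ _ e2) Hvw := cvw v w.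
have /cvgrPdist_le /(_ _ e2) Hwv := cvw w v.
have HU : nbhs u U by exact: open_nbhs_nbhs.
have /nbhs_ballP[d /= d0 Hd] : nbhs u [set x | U x /\
    (`|'D_v ('D_w f) u - 'D_v ('D_w f) x| <= e / 2 /\
     `|'D_w ('D_v f) u - 'D_w ('D_v f) x| <= e / 2)].
  exact: filterI HU (filterI Hvw Hwv).
(* Both [s *: v] and [r *: w] with s, r <= t stay within the ball of radius d. *)
pose t := d / (`|v| + `|w| + 1).
have N0 : 0 < `|v| + `|w| + 1 by rewrite ltr_pwDr // addr_ge0.
have t0 : 0 < t by rewrite divr_gt0.
have near_u s r : 0 <= s <= t -> 0 <= r <= t -> ball u d (s *: v + (r *: w + u)).
  move=> /andP[s0 st] /andP[r0 rt]; rewrite -ball_normE /=.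
  rewrite addrA opprD addrCA subrr addr0 normrN.
  apply: le_lt_trans (ler_normD _ _) _; rewrite !normrZ (ger0_norm s0) (ger0_norm r0).
  have -> : d = t * (`|v| + `|w| + 1) by rewrite /t divfK // gt_eqF.
  rewrite mulrDr mulr1; apply: ltr_pwDr => //.
  by rewrite mulrDr lerD // ler_wpM2r.
have [s [r [hs hr E1]]] := mixed_difference oU sf t0
  (fun s r hs hr => proj1 (Hd _ (near_u s r hs hr))).
have near_u' s' r' : 0 <= s' <= t -> 0 <= r' <= t ->
    ball u d (s' *: w + (r' *: v + u)).
  by move=> hs' hr'; rewrite addrCA; exact: near_u.
have [s' [r' [hs' hr' E2]]] := mixed_difference oU sf t0
  (fun s r hs hr => proj1 (Hd _ (near_u' s r hs hr))).
have [_ [_ /= B1]] := Hd _ (near_u _ _ hs hr).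
have [_ [/= B2 _]] := Hd _ (near_u' _ _ hs' hr').
have E : 'D_w ('D_v f) (s *: v + (r *: w + u)) =
         'D_v ('D_w f) (s' *: w + (r' *: v + u)).
  move: E1 E2; set a := 'D_w _ _; set b := 'D_v _ _ => E1 E2.
  have tab : t * (t * a) = t * (t * b).
    rewrite -[LHS]E1 -[RHS]E2 [t *: v + (t *: w + u)]addrCA.
    by rewrite !opprB [LHS]addrACA [RHS]addrACA; congr (_ + _); rewrite addrC.
  by move: tab => /(mulfI (lt0r_neq0 t0)) /(mulfI (lt0r_neq0 t0)).
rewrite E in B1.
have -> : e = e / 2 + e / 2 by rewrite -splitr.
set a := 'D_v ('D_w f) u in B2 *; set b := 'D_w ('D_v f) u in B1 *.
set c := 'D_v _ _ in B1 B2.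
have -> : a - b = (a - c) - (b - c) by rewrite opprB addrA subrK.
clearbody a b c.
have H1 := ler_normB (a - c) (b - c).
have H2 := lerD B2 B1.
exact: le_trans H1 H2.
Qed.
End SecondDerivatives.

(** * Derivatives of smooth functions *)

Section Calculus.
Context {R : realType} {n : nat}.
Implicit Types (U : set 'rV[R]_n) (f g : 'rV[R]_n -> R) (u v x y : 'rV[R]_n).

Lemma smooth_onD U f g : open U -> smooth_on U f -> smooth_on U g ->
  smooth_on U (fun u => f u + g u).
Proof.
by move=> oU sf sg; apply: smooth_genP => //; apply: gen_add; exact: gen_smooth.
Qed.

Lemma smooth_onM U f g : open U -> smooth_on U f -> smooth_on U g ->
  smooth_on U (fun u => f u * g u).
Proof.
by move=> oU sf sg; apply: smooth_genP => //; apply: gen_mul; exact: gen_smooth.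
Qed.

Lemma smooth_on_sum U m (F : 'I_m -> 'rV[R]_n -> R) : open U ->
  (forall i, smooth_on U (F i)) -> smooth_on U (fun u => \sum_i F i u).
Proof.
by move=> oU sF; apply: smooth_genP => //; apply: smooth_gen_sum => i; exact: gen_smooth.
Qed.

Lemma smooth_on_eq U f g : open U -> (forall u, U u -> f u = g u) ->
  smooth_on U f -> smooth_on U g.
Proof.
by move=> oU fg sf; apply: smooth_genP => //; apply: gen_ext fg _; exact: gen_smooth.
Qed.

Lemma smooth_derivable U f u v : smooth_on U f -> U u -> derivable f u v.
Proof. by move=> sf Uu; apply: diff_derivable; exact: smooth_on_diff sf Uu. Qed.

Lemma derive_smoothM U f g u v : smooth_on U f -> smooth_on U g -> U u ->
  'D_v (fun w => f w * g w) u = f u * 'D_v g u + g u * 'D_v f u.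
Proof.
move=> sf sg Uu; apply: deriveM.
  exact: smooth_derivable sf Uu.
exact: smooth_derivable sg Uu.
Qed.

Lemma derive_smoothD U f g u v : smooth_on U f -> smooth_on U g -> U u ->
  'D_v (fun w => f w + g w) u = 'D_v f u + 'D_v g u.
Proof.
move=> sf sg Uu; apply: deriveD.
  exact: smooth_derivable sf Uu.
exact: smooth_derivable sg Uu.
Qed.

Lemma derive_smooth_sum U m (F : 'I_m -> 'rV[R]_n -> R) u v :
  (forall i, smooth_on U (F i)) -> U u ->
  'D_v (fun w => \sum_i F i w) u = \sum_i 'D_v (F i) u.
Proof.
move=> sF Uu; rewrite -derive_sum; last by move=> i; exact: smooth_derivable (sF i) Uu.
by congr ('D_v _ u); apply/funext => w; rewrite fct_sumE.
Qed.

Lemma derive_coord f u v : differentiable f u ->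
  'D_v f u = \sum_i v 0 i * 'D_(basis i) f u.
Proof.
move=> df; rewrite deriveE // [in LHS](row_sum_delta v) linear_sum /=.
by apply: eq_bigr => i _; rewrite linearZ /= -deriveE.
Qed.

Lemma derive_dirB f u x y : differentiable f u -> 'D_(x - y) f u = 'D_x f u - 'D_y f u.
Proof. by move=> df; rewrite !deriveE // linearB. Qed.

Lemma derive_eq_on U f g u v : open U -> (forall w, U w -> f w = g w) -> U u ->
  'D_v f u = 'D_v g u.
Proof. by move=> oU fg Uu; apply: near_eq_derive; exact: near_open fg Uu. Qed.

End Calculus.

(** * Covariant derivatives and tensoriality of the curvature *)

Section Connection.
Context {R : realType} {n : nat}.
Implicit Types (U : set 'rV[R]_n) (u v x y z : 'rV[R]_n) (G : christoffel R n)
  (X Y Z : vector_field R n).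

(** The bilinear map Gamma_u(x, y) of tangent vectors. *)
Definition gam G u x y : 'rV[R]_n := \row_k \sum_i \sum_j x 0 i * y 0 j * G u i j k.

Fact gam_linear G u x : linear (gam G u x).
Proof.
move=> a y z; apply/rowP => k; rewrite !mxE mulr_sumr -big_split /=.
apply: eq_bigr => i _; rewrite mulr_sumr -big_split /=.
by apply: eq_bigr => j _; rewrite !mxE; ring.
Qed.
HB.instance Definition _ G u x :=
  GRing.isLinear.Build R 'rV[R]_n 'rV[R]_n _ (gam G u x) (gam_linear G u x).

Definition gamr G u y x := gam G u x y.

Fact gamr_linear G u y : linear (gamr G u y).
Proof.
move=> a x z; apply/rowP => k; rewrite !mxE mulr_sumr -big_split /=.
apply: eq_bigr => i _; rewrite mulr_sumr -big_split /=.
by apply: eq_bigr => j _; rewrite !mxE; ring.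
Qed.
HB.instance Definition _ G u y :=
  GRing.isLinear.Build R 'rV[R]_n 'rV[R]_n _ (gamr G u y) (gamr_linear G u y).

Lemma gamBl G u x y z : gam G u (x - y) z = gam G u x z - gam G u y z.
Proof. exact: (linearB (gamr G u z)). Qed.
Lemma gamZl G u a x z : gam G u (a *: x) z = a *: gam G u x z.
Proof. exact: (linearZZ (gamr G u z)). Qed.
Lemma gam_suml G u m (F : 'I_m -> 'rV[R]_n) z :
  gam G u (\sum_i F i) z = \sum_i gam G u (F i) z.
Proof. exact: (linear_sum (gamr G u z)). Qed.

Definition smooth_field U X := forall k, smooth_on U (fun u => X u 0 k).
Definition smooth_symbols U G := forall i j k, smooth_on U (fun u => G u i j k).
Definition ddir m v (F : 'rV[R]_n -> 'rV[R]_m) u : 'rV[R]_m :=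
  \row_k 'D_v (fun w => F w 0 k) u.
Definition dsymbols v G : christoffel R n := fun u i j k => 'D_v (fun w => G w i j k) u.

Lemma nablaE G X Y u : nabla G X Y u = ddir (X u) Y u + gam G u (X u) (Y u).
Proof. by apply/rowP => k; rewrite !mxE. Qed.

Lemma smooth_field_cst U x : smooth_field U (cst x : vector_field R n).
Proof. by move=> k; exact: smooth_cst. Qed.

Lemma smooth_gam U G X Y : open U -> smooth_symbols U G -> smooth_field U X ->
  smooth_field U Y -> smooth_field U (fun u => gam G u (X u) (Y u)).
Proof.
move=> oU sG sX sY k.
apply: (smooth_on_eq (f := fun u => \sum_i \sum_j X u 0 i * Y u 0 j * G u i j k)) => //.
  by move=> u _; rewrite mxE.
do 2!(apply: smooth_on_sum => // ?).
by do 2?apply: smooth_onM.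
Qed.

Lemma ddirE_smooth U X Y u k : smooth_field U Y -> U u ->
  ddir (X u) Y u 0 k = \sum_i X u 0 i * 'D_(basis i) (fun w => Y w 0 k) u.
Proof. by move=> sY Uu; rewrite mxE derive_coord //; exact: smooth_on_diff (sY k) Uu. Qed.

Lemma smooth_ddir U X Y : open U -> smooth_field U X -> smooth_field U Y ->
  smooth_field U (fun u => ddir (X u) Y u).
Proof.
move=> oU sX sY k.
apply: (smooth_on_eq (f := fun u => \sum_i X u 0 i * 'D_(basis i) (fun w => Y w 0 k) u)) => //.
  by move=> u Uu; rewrite (ddirE_smooth X k sY Uu).
by apply: smooth_on_sum => // i; apply: smooth_onM => //; exact: smooth_onS.
Qed.

Lemma smooth_fieldD U X Y : open U -> smooth_field U X -> smooth_field U Y ->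
  smooth_field U (fun u => X u + Y u).
Proof.
move=> oU sX sY k; apply: (smooth_on_eq (f := fun u => X u 0 k + Y u 0 k)) => //.
  by move=> u _; rewrite mxE.
exact: smooth_onD.
Qed.

Lemma smooth_fieldB U X Y : open U -> smooth_field U X -> smooth_field U Y ->
  smooth_field U (fun u => X u - Y u).
Proof.
move=> oU sX sY k.
apply: (smooth_on_eq (f := fun u => X u 0 k + cst (- 1) u * Y u 0 k)) => //.
  by move=> u _; rewrite !mxE mulN1r.
by apply: smooth_onD => //; apply: smooth_onM => //; exact: smooth_cst.
Qed.

Lemma smooth_field_eq U X Y : open U -> (forall u, U u -> X u = Y u) ->
  smooth_field U X -> smooth_field U Y.
Proof. by move=> oU XY sX k; apply: smooth_on_eq (sX k) => // u /XY ->. Qed.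

Lemma smooth_nabla U G X Y : open U -> smooth_symbols U G -> smooth_field U X ->
  smooth_field U Y -> smooth_field U (nabla G X Y).
Proof.
move=> oU sG sX sY.
apply: (smooth_field_eq (X := fun u => ddir (X u) Y u + gam G u (X u) (Y u))) => //.
  by move=> u _; rewrite nablaE.
by apply: smooth_fieldD; [|exact: smooth_ddir|exact: smooth_gam].
Qed.

Lemma ddirD U X Y u v : smooth_field U X -> smooth_field U Y -> U u ->
  ddir v (fun u => X u + Y u) u = ddir v X u + ddir v Y u.
Proof.
move=> sX sY Uu; apply/rowP => k; rewrite !mxE.
rewrite -(derive_smoothD v (sX k) (sY k) Uu); congr ('D_v _ u).
by apply/funext => w; rewrite mxE.
Qed.

Lemma ddir_eq U X Y u v : open U -> (forall w, U w -> X w = Y w) -> U u ->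
  ddir v X u = ddir v Y u.
Proof.
by move=> oU XY Uu; apply/rowP => k; rewrite !mxE; apply: (derive_eq_on v oU _ Uu) => w /XY ->.
Qed.

Lemma ddir_cst x u v : ddir v (cst x) u = 0 :> 'rV[R]_n.
Proof. by apply/rowP => k; rewrite !mxE derive_cst. Qed.

Lemma ddir_dirB U X u x y : smooth_field U X -> U u ->
  ddir (x - y) X u = ddir x X u - ddir y X u.
Proof.
by move=> sX Uu; apply/rowP => k; rewrite !mxE derive_dirB //; exact: smooth_on_diff (sX k) Uu.
Qed.

Lemma ddir_gam U G X Y u v : open U -> smooth_symbols U G -> smooth_field U X ->
  smooth_field U Y -> U u ->
  ddir v (fun u => gam G u (X u) (Y u)) u =
  gam (dsymbols v G) u (X u) (Y u) + gam G u (ddir v X u) (Y u) + gam G u (X u) (ddir v Y u).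
Proof.
move=> oU sG sX sY Uu; apply/rowP => k; rewrite !mxE.
rewrite (_ : (fun w => _) = fun w => \sum_i \sum_j X w 0 i * Y w 0 j * G w i j k); last first.
  by apply/funext => w; rewrite mxE.
have sXY i j : smooth_on U (fun w => X w 0 i * Y w 0 j) by exact: smooth_onM.
have sT i j : smooth_on U (fun w => X w 0 i * Y w 0 j * G w i j k) by exact: smooth_onM.
rewrite (derive_smooth_sum (U := U)) //; last by move=> i; exact: smooth_on_sum.
rewrite -!big_split /=; apply: eq_bigr => i _.
rewrite (derive_smooth_sum (U := U)) // -!big_split /=; apply: eq_bigr => j _.
rewrite (derive_smoothM v (sXY i j) (sG i j k) Uu) (derive_smoothM v (sX i) (sY j) Uu).
rewrite !mxE /dsymbols; move: ('D_v _ _) ('D_v _ _) ('D_v _ _) => a b c.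
move: (X u 0 i) (Y u 0 j) (G u i j k) => p q r; ring.
Qed.

Lemma gam0l G u z : gam G u 0 z = 0.
Proof. exact: (linear0 (gamr G u z)). Qed.

Lemma ddir_gam_cst U G u v x y : open U -> smooth_symbols U G -> U u ->
  ddir v (fun u => gam G u x y) u = gam (dsymbols v G) u x y.
Proof.
move=> oU sG Uu.
rewrite (ddir_gam v oU sG (smooth_field_cst (U := U) x) (smooth_field_cst (U := U) y) Uu).
by rewrite !ddir_cst gam0l linear0 !addr0.
Qed.

(** The direction [X v] of the inner derivative varies as well, whence the first
    term. *)
Lemma ddir_ddir U X Y u x : open U -> smooth_field U X -> smooth_field U Y -> U u ->
  ddir x (fun v => ddir (X v) Y v) u = ddir (ddir x X u) Y u + ddir x (ddir (X u) Y) u.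
Proof.
move=> oU sX sY Uu; apply/rowP => k; rewrite !mxE.
pose d i v := 'D_(basis i) (fun w => Y w 0 k) v.
have sd i : smooth_on U (d i) by exact: smooth_onS.
have dY v : U v -> differentiable (fun w => Y w 0 k) v by exact: smooth_on_diff.
rewrite (derive_eq_on (g := fun v => \sum_i X v 0 i * d i v) x oU) //; last first.
  by move=> v Uv; rewrite (ddirE_smooth X k sY Uv).
rewrite (derive_eq_on (f := fun w => ddir (X u) Y w 0 k)
    (g := fun v => \sum_i X u 0 i * d i v) x oU) //; last first.
  by move=> v Uv; rewrite (ddirE_smooth (cst (X u)) k sY Uv).
rewrite (derive_coord (ddir x X u) (dY u Uu)).
have sc i : smooth_on U (cst (X u 0 i)) by exact: smooth_cst.
rewrite (derive_smooth_sum (U := U)) //; last by move=> i; exact: smooth_onM.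
rewrite (derive_smooth_sum (U := U)) //; last by move=> i; exact: (smooth_onM oU (sc i) (sd i)).
rewrite -big_split /=; apply: eq_bigr => i _.
rewrite (derive_smoothM x (sX i) (sd i) Uu) (derive_smoothM x (sc i) (sd i) Uu).
rewrite derive_cst mulr0 addr0 addrC mxE; congr (_ + _); exact: mulrC.
Qed.

Lemma ddir_comm U X u x y : open U -> smooth_field U X -> U u ->
  ddir x (ddir y X) u = ddir y (ddir x X) u.
Proof.
move=> oU sX Uu.
have E a k : (fun w => ddir a X w 0 k) = 'D_a (fun w => X w 0 k).
  by apply/funext => w; rewrite mxE.
have D a b k : ddir a (ddir b X) u 0 k = 'D_a (fun w => ddir b X w 0 k) u.
  by rewrite /ddir mxE.
apply/rowP => k.
apply: etrans (D x y k) _.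
apply: etrans _ (esym (D y x k)).
rewrite (E x k) (E y k).
exact: (derive_comm x y oU (sX k) Uu).
Qed.

(** The value R(x, y) z of the curvature tensor, read off from vector fields with
    constant components, for which all Lie brackets vanish. *)
Definition curv G u x y z : 'rV[R]_n :=
  gam (dsymbols x G) u y z - gam (dsymbols y G) u x z +
  (gam G u x (gam G u y z) - gam G u y (gam G u x z)).

Lemma lie_bracketE X Y u : lie_bracket X Y u = ddir (X u) Y u - ddir (Y u) X u.
Proof. by apply/rowP => k; rewrite !mxE. Qed.

Lemma nabla_nabla U G X Y Z u : open U -> smooth_symbols U G ->
  smooth_field U X -> smooth_field U Y -> smooth_field U Z -> U u ->
  nabla G X (nabla G Y Z) u =
  ddir (ddir (X u) Y u) Z u + ddir (X u) (ddir (Y u) Z) u +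
  gam (dsymbols (X u) G) u (Y u) (Z u) + gam G u (ddir (X u) Y u) (Z u) +
  gam G u (Y u) (ddir (X u) Z u) + gam G u (X u) (ddir (Y u) Z u) +
  gam G u (X u) (gam G u (Y u) (Z u)).
Proof.
move=> oU sG sX sY sZ Uu; rewrite nablaE.
rewrite (ddir_eq (Y := fun v => ddir (Y v) Z v + gam G v (Y v) (Z v)) _ oU) //;
  last by move=> w _; rewrite nablaE.
rewrite (ddirD (U := U)) //; [|exact: smooth_ddir|exact: smooth_gam].
rewrite (ddir_ddir _ oU) // (ddir_gam _ oU) // nablaE linearD /=.
by rewrite !addrA.
Qed.

(** The curvature depends on the values of the fields alone: in the commutator of
    covariant derivatives, the first derivatives of X and Y are cancelled by the
    bracket term, those of Z cancel each other, and so do the second derivatives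
    of Z by their symmetry. *)
Theorem curvatureE U G X Y Z u : open U -> smooth_symbols U G ->
  smooth_field U X -> smooth_field U Y -> smooth_field U Z -> U u ->
  curvature G X Y Z u = curv G u (X u) (Y u) (Z u).
Proof.
move=> oU sG sX sY sZ Uu.
have -> : curvature G X Y Z u = nabla G X (nabla G Y Z) u - nabla G Y (nabla G X Z) u
    - nabla G (lie_bracket X Y) Z u by [].
rewrite (nabla_nabla oU) // (nabla_nabla oU) // nablaE lie_bracketE gamBl.
rewrite (ddir_dirB _ _ sZ Uu) (ddir_comm (X u) (Y u) oU sZ Uu) /curv.
move: (ddir (ddir _ _ _) _ _) (ddir (ddir _ _ _) _ _) (ddir _ (ddir _ _) _) => a b c.
move: (gam _ _ (ddir _ _ _) _) (gam _ _ (ddir _ _ _) _) => d e.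
move: (gam _ _ _ (ddir _ _ _)) (gam _ _ _ (ddir _ _ _)) => f g.
move: (gam _ _ _ _) (gam _ _ _ _) (gam _ _ _ _) (gam _ _ _ _) => p q r s.
by apply/rowP => k; rewrite !mxE; ring.
Qed.
End Connection.

(** * The Szabo operator as a tensor *)

Section Szabo.
Context {R : realType} {n : nat}.
Implicit Types (U : set 'rV[R]_n) (u v x y z : 'rV[R]_n) (G : christoffel R n).

(** (nabla_x R)(y, x) x, in terms of the curvature tensor. *)
Definition szabo_vector G u x y : 'rV[R]_n :=
  ddir x (fun w => curv G w y x x) u + gam G u x (curv G u y x x)
  - curv G u (gam G u x y) x x - curv G u y (gam G u x x) x
  - curv G u y x (gam G u x x).

Lemma smooth_dsymbols U G v : smooth_symbols U G -> smooth_symbols U (dsymbols v G).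
Proof. by move=> sG i j k; exact: smooth_onS. Qed.

Lemma nabla_cst G x y u : nabla G (cst x) (cst y) u = gam G u x y.
Proof. by rewrite nablaE ddir_cst add0r. Qed.

Lemma szabo_operatorE U G u x i j : open U -> smooth_symbols U G -> U u ->
  szabo_operator G u x i j = szabo_vector G u x (basis i) 0 j.
Proof.
move=> oU sG Uu; rewrite /szabo_operator mxE; congr (_ _ j).
set y := basis i.
have sc a : smooth_field U (cst a : vector_field R n) by exact: smooth_field_cst.
have sn a b : smooth_field U (nabla G (cst a) (cst b)) by exact: smooth_nabla.
have -> : nabla_curvature G (cst x) (cst y) (cst x) (cst x) u =
  nabla G (cst x) (curvature G (cst y) (cst x) (cst x)) u
  - curvature G (nabla G (cst x) (cst y)) (cst x) (cst x) u
  - curvature G (cst y) (nabla G (cst x) (cst x)) (cst x) u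
  - curvature G (cst y) (cst x) (nabla G (cst x) (cst x)) u by [].
rewrite (curvatureE oU sG (sn x y) (sc x) (sc x) Uu).
rewrite (curvatureE oU sG (sc y) (sn x x) (sc x) Uu).
rewrite (curvatureE oU sG (sc y) (sc x) (sn x x) Uu).
rewrite nablaE (curvatureE oU sG (sc y) (sc x) (sc x) Uu) !nabla_cst.
have H : ddir x (curvature G (cst y) (cst x) (cst x)) u =
    ddir x (fun w => curv G w y x x) u.
  apply: (ddir_eq x oU _ Uu) => w Uw.
  exact: (curvatureE oU sG (sc y) (sc x) (sc x) Uw).
by rewrite /szabo_vector -H.
Qed.

Lemma smooth_curv_cst U G x y z : open U -> smooth_symbols U G ->
  smooth_field U (fun u => curv G u x y z).
Proof.
move=> oU sG.
have sc a : smooth_field U (cst a : vector_field R n) by exact: smooth_field_cst.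
have sg H a b : smooth_symbols U H -> smooth_field U (fun u => gam H u a b).
  by move=> sH; exact: (smooth_gam oU sH (sc a) (sc b)).
by apply: smooth_fieldD => //; apply: smooth_fieldB => //;
  [apply: sg; exact: smooth_dsymbols|apply: sg; exact: smooth_dsymbols|
   exact: (smooth_gam oU sG (sc _) (sg _ _ _ sG))|
   exact: (smooth_gam oU sG (sc _) (sg _ _ _ sG))].
Qed.

Lemma gam_dsymbols_coord U G u v x y : smooth_symbols U G -> U u ->
  gam (dsymbols v G) u x y = \sum_k v 0 k *: gam (dsymbols (basis k) G) u x y.
Proof.
move=> sG Uu; apply/rowP => l; rewrite mxE summxE.
under [RHS]eq_bigr do rewrite mxE mxE mulr_sumr.
rewrite [RHS]exchange_big /=; apply: eq_bigr => i _.
under [RHS]eq_bigr do rewrite mulr_sumr.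
rewrite [RHS]exchange_big /=; apply: eq_bigr => j _.
rewrite /dsymbols (derive_coord v (smooth_on_diff (sG i j l) Uu)) mulr_sumr.
by apply: eq_bigr => k _; rewrite mulrCA.
Qed.

Lemma gam_coordl G u x y : gam G u x y = \sum_k x 0 k *: gam G u (basis k) y.
Proof.
rewrite {1}(row_sum_delta x) gam_suml; apply: eq_bigr => k _; exact: gamZl.
Qed.

Lemma gam_coordr G u x y : gam G u x y = \sum_k y 0 k *: gam G u x (basis k).
Proof.
rewrite {1}(row_sum_delta y) linear_sum; apply: eq_bigr => k _; exact: linearZZ.
Qed.

Lemma curv_coordl U G u x y z : smooth_symbols U G -> U u ->
  curv G u x y z = \sum_k x 0 k *: curv G u (basis k) y z.
Proof.
move=> sG Uu; rewrite /curv.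
under [RHS]eq_bigr do rewrite scalerDr !scalerBr.
rewrite big_split /= !sumrB; congr (_ - _ + (_ - _)).
- exact: gam_dsymbols_coord sG Uu.
- exact: gam_coordl.
- exact: gam_coordl.
- rewrite (gam_coordl _ _ x z) linear_sum; apply: eq_bigr => k _; exact: linearZZ.
Qed.

End Szabo.

(** * The Koszul formula *)

Section Koszul.
Context {R : realType} {n : nat}.
Implicit Types (U : set 'rV[R]_n) (u v x y z : 'rV[R]_n) (g : 'rV[R]_n -> 'M[R]_n).

Definition bil m (A : 'M[R]_m) (x y : 'rV[R]_m) : R := \sum_i \sum_j x 0 i * y 0 j * A i j.
Definition smooth_mx U g := forall i j, smooth_on U (fun u => g u i j).
Definition dentries v g u : 'M[R]_n := \matrix_(i, j) 'D_v (fun w => g w i j) u.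

Lemma smooth_bil U g x y : open U -> smooth_mx U g -> smooth_on U (fun w => bil (g w) x y).
Proof.
move=> oU sg; do 2!(apply: smooth_on_sum => // ?).
by apply: smooth_onM => //; exact: smooth_cst.
Qed.

Lemma derive_bil U g u v x y : open U -> smooth_mx U g -> U u ->
  'D_v (fun w => bil (g w) x y) u = bil (dentries v g u) x y.
Proof.
move=> oU sg Uu; rewrite /bil.
have sc i j : smooth_on U (cst (x 0 i * y 0 j)) by exact: smooth_cst.
have sT i j : smooth_on U (fun w => x 0 i * y 0 j * g w i j).
  exact: (smooth_onM oU (sc i j)).
rewrite (derive_smooth_sum (U := U)) //; last by move=> i; exact: smooth_on_sum.
apply: eq_bigr => i _; rewrite (derive_smooth_sum (U := U)) //; apply: eq_bigr => j _.
by rewrite (derive_smoothM v (sc i j) (sg i j) Uu) derive_cst mulr0 addr0 mxE.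
Qed.

Lemma bil_dentries_coord U g u v x y : open U -> smooth_mx U g -> U u ->
  bil (dentries v g u) x y = \sum_k v 0 k * bil (dentries (basis k) g u) x y.
Proof.
move=> oU sg Uu; rewrite -(derive_bil v x y oU sg Uu).
rewrite (derive_coord v (smooth_on_diff (smooth_bil x y oU sg) Uu)).
by apply: eq_bigr => k _; rewrite (derive_bil _ x y oU sg Uu).
Qed.

Lemma bil_basisr m (A : 'M[R]_m) (x : 'rV[R]_m) l : bil A x (basis l) = \sum_i x 0 i * A i l.
Proof.
apply: eq_bigr => i _; rewrite (bigD1 l) //= mxE !eqxx mulr1 big1 ?addr0 // => j jl.
by rewrite mxE (negPf jl) andbF mulr0 mul0r.
Qed.

(** Twice the metric products of nabla_y z, for constant fields y and z, with the
    basis vectors. *)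
Definition koszul g u y z : 'rV[R]_n :=
  \row_l (bil (dentries y g u) z (basis l) + bil (dentries z g u) y (basis l) -
          bil (dentries (basis l) g u) y z).

Lemma levi_civitaE U g u y z : open U -> smooth_mx U g -> U u ->
  gam (levi_civita g) u y z = 2^-1 *: (koszul g u y z *m (invmx (g u))^T).
Proof.
move=> oU sg Uu; apply/rowP => k; rewrite mxE [RHS]mxE [in RHS]mxE.
transitivity (2^-1 * \sum_i \sum_j \sum_l (y 0 i * z 0 j * (invmx (g u) k l *
  (dentries (basis i) g u j l + dentries (basis j) g u i l - dentries (basis l) g u i j)))).
  rewrite mulr_sumr; apply: eq_bigr => i _; rewrite mulr_sumr.
  apply: eq_bigr => j _; rewrite /levi_civita mulrCA -mulr_sumr; congr (_ * (_ * _)).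
  by apply: eq_bigr => l _; rewrite !mxE.
congr (_ * _); under eq_bigr do rewrite exchange_big /=.
rewrite exchange_big /=; apply: eq_bigr => l _.
rewrite [(_^T) _ _]mxE [koszul _ _ _ _ _ _]mxE.
rewrite (bil_dentries_coord y z _ oU sg Uu) (bil_dentries_coord z y _ oU sg Uu).
transitivity ((\sum_i \sum_j y 0 i * z 0 j * dentries (basis i) g u j l +
  \sum_i \sum_j y 0 i * z 0 j * dentries (basis j) g u i l -
  \sum_i \sum_j y 0 i * z 0 j * dentries (basis l) g u i j) * invmx (g u) k l).
  rewrite -big_split -sumrB /= mulr_suml; apply: eq_bigr => i _.
  rewrite -big_split -sumrB /= mulr_suml; apply: eq_bigr => j _.
  by ring.
congr ((_ + _ - _) * _).
  apply: eq_bigr => i _; rewrite bil_basisr mulr_sumr.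
  by apply: eq_bigr => j _; rewrite mulrA.
rewrite exchange_big; apply: eq_bigr => j _; rewrite bil_basisr mulr_sumr.
by apply: eq_bigr => i _; rewrite mulrA; congr (_ * _); rewrite mulrC.
Qed.

End Koszul.

(** * The extension metric in a chart *)

Section Dot.
Context {R : realType} {n : nat}.
Implicit Types (a b x y : 'rV[R]_n).
Definition dot a b : R := \sum_k a 0 k * b 0 k.

Lemma dot0l b : dot 0 b = 0.
Proof. by rewrite /dot big1 // => k _; rewrite mxE mul0r. Qed.
Lemma dotC a b : dot a b = dot b a.
Proof. by apply: eq_bigr => k _; rewrite mulrC. Qed.
Fact dot_linear a : linear (dot a : 'rV[R]_n -> R^o).
Proof.
move=> c x y; rewrite /dot scaler_sumr -big_split /=; apply: eq_bigr => k _.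
by rewrite !mxE /GRing.scale /=; ring.
Qed.
HB.instance Definition _ a :=
  GRing.isLinear.Build R 'rV[R]_n R^o _ (dot a : 'rV[R]_n -> R^o) (dot_linear a).
Lemma dotDr a x y : dot a (x + y) = dot a x + dot a y.
Proof. exact: (linearD (dot a : 'rV[R]_n -> R^o)). Qed.
Lemma dotNr a y : dot a (- y) = - dot a y.
Proof. exact: (linearN (dot a : 'rV[R]_n -> R^o)). Qed.
Lemma dotBr a x y : dot a (x - y) = dot a x - dot a y.
Proof. exact: (linearB (dot a : 'rV[R]_n -> R^o)). Qed.
Lemma dotZr a c y : dot a (c *: y) = c * dot a y.
Proof. exact: (linearZZ (dot a : 'rV[R]_n -> R^o)). Qed.
Lemma dotNl a y : dot (- a) y = - dot a y.
Proof. by rewrite dotC [in RHS]dotC; exact: (linearN (dot y : 'rV[R]_n -> R^o)). Qed.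
Lemma dot_sumr a m (F : 'I_m -> 'rV[R]_n) : dot a (\sum_i F i) = \sum_i dot a (F i).
Proof. exact: (linear_sum (dot a : 'rV[R]_n -> R^o)). Qed.
Lemma dot_basisl k y : dot (basis k) y = y 0 k.
Proof.
rewrite /dot (bigD1 k) //= mxE !eqxx mul1r big1 ?addr0 // => j jk.
by rewrite mxE (negPf jk) andbF mul0r.
Qed.
Lemma bil_basisl (A : 'M[R]_n) k y : bil A (basis k) y = \sum_j y 0 j * A k j.
Proof.
rewrite /bil (bigD1 k) //= [X in _ + X]big1 ?addr0; last first.
  by move=> i ik; rewrite big1 // => j _; rewrite mxE (negPf ik) andbF !mul0r.
by apply: eq_bigr => j _; rewrite mxE !eqxx mul1r.
Qed.
Lemma bil0l (A : 'M[R]_n) y : bil A 0 y = 0.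
Proof. by rewrite /bil big1 // => i _; rewrite big1 // => j _; rewrite mxE !mul0r. Qed.
Lemma bil0r (A : 'M[R]_n) y : bil A y 0 = 0.
Proof. by rewrite /bil big1 // => i _; rewrite big1 // => j _; rewrite mxE mulr0 mul0r. Qed.
Lemma bil0m y x : bil 0 x y = 0.
Proof. by rewrite /bil big1 // => i _; rewrite big1 // => j _; rewrite mxE mulr0. Qed.
End Dot.

Section ExtensionMetric.
Context {R : realType} {n : nat}.
Implicit Types (u y z : 'rV[R]_n) (w V X Y Z : 'rV[R]_(n + n)).
Variables (U : set 'rV[R]_n) (G : christoffel R n) (phi : 'rV[R]_n -> 'M[R]_n).
Hypotheses (oU : open U) (sG : smooth_symbols U G) (sphi : smooth_mx U phi).

Let W : set 'rV[R]_(n + n) := lsubmx @^-1` U.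
Let oW : open W. Proof. exact: open_lsubmx. Qed.

(** The horizontal block of the deformed Riemannian extension of a local
    connection [G] and tensor [phi]; [lsubmx w] is the base point and [rsubmx w] the
    covector. *)
Definition riem_ext_h w : 'M[R]_n :=
  \matrix_(i, j) (phi (lsubmx w) i j - 2 * \sum_k rsubmx w 0 k * G (lsubmx w) i j k).
Definition riem_ext w : 'M[R]_(n + n) := block_mx (riem_ext_h w) 1%:M 1%:M 0.

Lemma derive_rsubmx w V k : 'D_V (fun v : 'rV[R]_(n + n) => rsubmx v 0 k) w = rsubmx V 0 k.
Proof.
rewrite (_ : (fun _ => _) = fun v : 'rV_(n + n) => v 0 (rshift n k)); last first.
  by apply/funext => v; rewrite mxE.
by rewrite [RHS]mxE -[in RHS](derive_id w V) derive_mx ?mxE.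
Qed.

Lemma derive_dot w V (h : vector_field R n) : smooth_field U h -> W w ->
  'D_V (fun v => dot (rsubmx v) (h (lsubmx v))) w =
  dot (rsubmx V) (h (lsubmx w)) + dot (rsubmx w) (ddir (lsubmx V) h (lsubmx w)).
Proof.
move=> sh Ww; rewrite /dot.
have sr k : smooth_on W (fun v => rsubmx v 0 k) by exact: smooth_rsubmx.
have shl k : smooth_on W (fun v => h (lsubmx v) 0 k).
  exact: (smooth_pullback (f := fun u => h u 0 k)).
have st k : smooth_on W (fun v => rsubmx v 0 k * h (lsubmx v) 0 k).
  exact: smooth_onM.
rewrite (derive_smooth_sum (U := W)) // -big_split; apply: eq_bigr => k _ /=.
rewrite (derive_smoothM V (sr k) (shl k) Ww) derive_rsubmx.
rewrite (derive_lsubmx (fun u => h u 0 k)) [ddir _ _ _ _ _]mxE addrC; congr (_ + _).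
exact: mulrC.
Qed.

(** Along a fibre the base point is constant, so [f] and [h] may be arbitrary. *)
Lemma derive_along_fiber (f : 'rV[R]_n -> R) (h : vector_field R n) w (al : 'rV[R]_n) :
  'D_(row_mx 0 al) (fun v => f (lsubmx v) + dot (rsubmx v) (h (lsubmx v))) w =
  dot al (h (lsubmx w)).
Proof.
transitivity ('D_(row_mx 0 al) (fun v : 'rV_(n + n) =>
    f (lsubmx w) + dot (rsubmx v) (h (lsubmx w))) w).
  rewrite /derive /=; set A := (fun k : R => _); set B := (X in _ = lim (fmap X _)).
  have -> // : A = B; apply/funext => k; rewrite /A /B.
  have -> // : lsubmx (k *: row_mx 0 al + w) = lsubmx w.
  by rewrite linearD linearZ /= row_mxKl scaler0 add0r.
have sr k : smooth_on setT (fun v : 'rV[R]_(n + n) => rsubmx v 0 k * h (lsubmx w) 0 k).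
  exact: (smooth_onM openT (@smooth_rsubmx R n setT k)
           (smooth_cst (h (lsubmx w) 0 k))).
have ss : smooth_on setT (fun v : 'rV[R]_(n + n) => dot (rsubmx v) (h (lsubmx w))).
  by apply: smooth_on_sum => //; exact: openT.
rewrite (derive_smoothD _ (smooth_cst _) ss I) derive_cst add0r /dot.
rewrite (derive_smooth_sum (U := setT)) //; apply: eq_bigr => k _.
rewrite (derive_smoothM _ (@smooth_rsubmx _ _ setT k) (smooth_cst _) I).
by rewrite derive_cst mulr0 add0r derive_rsubmx row_mxKr mulrC.
Qed.

Lemma bil_riem_ext_h w y z : bil (riem_ext_h w) y z =
  bil (phi (lsubmx w)) y z + (- 2) * dot (rsubmx w) (gam G (lsubmx w) y z).
Proof.
rewrite /bil /dot mulr_sumr.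
transitivity (\sum_i \sum_j (y 0 i * z 0 j * phi (lsubmx w) i j +
   \sum_k (- 2 * (rsubmx w 0 k * (y 0 i * z 0 j * G (lsubmx w) i j k))))).
  apply: eq_bigr => i _; apply: eq_bigr => j _; rewrite [riem_ext_h _ _ _]mxE.
  rewrite mulrBr; congr (_ + _); rewrite mulr_sumr -mulrN -sumrN mulr_sumr.
  apply: eq_bigr => k _; ring.
under eq_bigr do rewrite big_split /=.
rewrite big_split /=; congr (_ + _).
under eq_bigr do rewrite exchange_big /=.
rewrite exchange_big /=; apply: eq_bigr => k _; rewrite [gam _ _ _ _ _ _]mxE !mulr_sumr.
by apply: eq_bigr => i _; rewrite !mulr_sumr.
Qed.

Lemma bil_riem_ext w X Y : bil (riem_ext w) X Y =
  bil (phi (lsubmx w)) (lsubmx X) (lsubmx Y) +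
  (- 2) * dot (rsubmx w) (gam G (lsubmx w) (lsubmx X) (lsubmx Y)) +
  (dot (lsubmx X) (rsubmx Y) + dot (rsubmx X) (lsubmx Y)).
Proof.
have E1 : bil (riem_ext w) X Y = bil (riem_ext_h w) (lsubmx X) (lsubmx Y) +
    (dot (lsubmx X) (rsubmx Y) + dot (rsubmx X) (lsubmx Y)).
  rewrite /bil big_split_ord /= addrA; congr (_ + _).
    rewrite /dot -big_split /=; apply: eq_bigr => i _.
    rewrite big_split_ord /=; congr (_ + _).
      by apply: eq_bigr => j _; rewrite /riem_ext block_mxEul !mxE.
    rewrite (bigD1 i) //= [X in _ + X]big1 ?addr0.
      by rewrite /riem_ext block_mxEur !mxE eqxx mulr1.
    by move=> j ji; rewrite /riem_ext block_mxEur [1%:M _ _]mxE eq_sym (negPf ji) mulr0.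
  apply: eq_bigr => i _; rewrite big_split_ord /= [X in _ + X]big1 ?addr0; last first.
    by move=> j _; rewrite /riem_ext block_mxEdr [X in _ * X]mxE mulr0.
  rewrite (bigD1 i) //= big1 ?addr0.
    by rewrite /riem_ext block_mxEdl !mxE eqxx mulr1.
  by move=> j ji; rewrite /riem_ext block_mxEdl [1%:M _ _]mxE eq_sym (negPf ji) mulr0.
by rewrite E1 bil_riem_ext_h.
Qed.

Lemma smooth_gam_cst y z : smooth_field U (fun u => gam G u y z).
Proof. exact: (smooth_gam oU sG (smooth_field_cst _) (smooth_field_cst _)). Qed.

Lemma smooth_dot_pull (h : vector_field R n) : smooth_field U h ->
  smooth_on W (fun v => dot (rsubmx v) (h (lsubmx v))).
Proof.
move=> sh; apply: smooth_on_sum => // k; apply: smooth_onM => //.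
  exact: smooth_rsubmx.
exact: (smooth_pullback (f := fun u => h u 0 k)).
Qed.

Lemma smooth_riem_ext : smooth_mx W riem_ext.
Proof.
have sc (c : R) f : (forall w, f w = c) -> smooth_on W f.
  by move=> fc; apply: (smooth_on_eq oW _ (smooth_cst c)) => w _.
move=> i j; case: (split_ordP i) => {}i ->; case: (split_ordP j) => {}j ->.
- pose h u : 'rV[R]_n := \row_k G u i j k.
  have sh : smooth_field U h.
    by move=> k; apply: (smooth_on_eq oU _ (sG i j k)) => u _; rewrite mxE.
  apply: (smooth_on_eq (f := fun w => phi (lsubmx w) i j +
      cst (- 2) w * dot (rsubmx w) (h (lsubmx w))) oW).
    move=> w _; rewrite /riem_ext block_mxEul mxE /= mulNr; congr (_ - 2 * _).
    by apply: eq_bigr => k _; rewrite [h _ _ _]mxE.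
  apply: (smooth_onD oW (smooth_pullback oU (sphi i j))).
  exact: (smooth_onM oW (smooth_cst (- 2)) (smooth_dot_pull sh)).
- by apply: (sc (1%:M i j)) => w; rewrite /riem_ext block_mxEur.
- by apply: (sc (1%:M i j)) => w; rewrite /riem_ext block_mxEdl.
- by apply: (sc 0) => w; rewrite /riem_ext block_mxEdr mxE.
Qed.

(** The pairing of base and fibre components is constant, so only the horizontal
    block contributes. *)
Lemma bil_dentries_riem_ext V w X Y : W w -> bil (dentries V riem_ext w) X Y =
  bil (dentries (lsubmx V) phi (lsubmx w)) (lsubmx X) (lsubmx Y) +
  (- 2) * (dot (rsubmx V) (gam G (lsubmx w) (lsubmx X) (lsubmx Y)) +
   dot (rsubmx w) (gam (dsymbols (lsubmx V) G) (lsubmx w) (lsubmx X) (lsubmx Y))).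
Proof.
move=> Ww; rewrite -(derive_bil V X Y oW smooth_riem_ext Ww).
pose f (v : 'rV[R]_(n + n)) := bil (phi (lsubmx v)) (lsubmx X) (lsubmx Y).
pose d v := dot (rsubmx v) (gam G (lsubmx v) (lsubmx X) (lsubmx Y)).
pose c := dot (lsubmx X) (rsubmx Y) + dot (rsubmx X) (lsubmx Y).
rewrite (_ : (fun _ => _) = fun v => (f v + cst (- 2) v * d v) + cst c v); last first.
  by apply/funext => v; exact: bil_riem_ext.
have sb := smooth_bil (lsubmx X) (lsubmx Y) oU sphi.
have sf : smooth_on W f by exact: (smooth_pullback oU sb).
have sd : smooth_on W d by exact: (smooth_dot_pull (smooth_gam_cst _ _)).
have scd : smooth_on W (fun v => cst (- 2) v * d v).
  by apply: smooth_onM => //; exact: smooth_cst.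
have sfd : smooth_on W (fun v => f v + cst (- 2) v * d v) by exact: smooth_onD.
rewrite (derive_smoothD V sfd (smooth_cst c) Ww) derive_cst addr0.
rewrite (derive_smoothD V sf scd Ww); congr (_ + _).
  by rewrite (derive_lsubmx (fun u => bil (phi u) _ _)) (derive_bil _ _ _ oU sphi Ww).
rewrite (derive_smoothM V (smooth_cst (- 2)) sd Ww) derive_cst mulr0 addr0.
congr (_ * _); rewrite (derive_dot V (smooth_gam_cst (lsubmx X) (lsubmx Y)) Ww).
by rewrite (ddir_gam_cst _ _ _ oU sG Ww).
Qed.

Lemma invmx_riem_ext w : invmx (riem_ext w) = block_mx 0 1%:M 1%:M (- riem_ext_h w).
Proof.
have E : riem_ext w *m block_mx 0 1%:M 1%:M (- riem_ext_h w) = 1%:M.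
  rewrite /riem_ext mulmx_block !(mulmx0, mul0mx, mulmx1, mul1mx, add0r, addr0).
  by rewrite subrr -scalar_mx_block.
have [u1 _] := mulmx1_unit E.
by rewrite -[RHS](mulKmx u1) E mulmx1.
Qed.

End ExtensionMetric.

(** * Levi-Civita connection of the extension *)

Section ExtensionConnection.
Context {R : realType} {n : nat}.
Implicit Types (u y z : 'rV[R]_n) (w V X Y Z : 'rV[R]_(n + n)).
Variables (U : set 'rV[R]_n) (G : christoffel R n) (phi : 'rV[R]_n -> 'M[R]_n).
Hypotheses (oU : open U) (sG : smooth_symbols U G) (sphi : smooth_mx U phi).

Let W : set 'rV[R]_(n + n) := lsubmx @^-1` U.
Let oW : open W. Proof. exact: open_lsubmx. Qed.
Let LC : christoffel R (n + n) := levi_civita (riem_ext G phi).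

(** The fibre component, paired with e, of the covariant derivative of constant
    fields Y, Z is an affine function of the covector omega: [fiber_part] is its value
    at omega = 0, and its linear part is the pairing of omega with [fiber_slope]. *)
Definition fiber_part u Y Z (e : 'rV[R]_n) : R :=
  2^-1 * (bil (dentries (lsubmx Y) phi u) (lsubmx Z) e +
          bil (dentries (lsubmx Z) phi u) (lsubmx Y) e -
          bil (dentries e phi u) (lsubmx Y) (lsubmx Z)) -
  bil (phi u) e (gam G u (lsubmx Y) (lsubmx Z)) -
  dot (rsubmx Y) (gam G u (lsubmx Z) e) -
  dot (rsubmx Z) (gam G u (lsubmx Y) e).

Definition fiber_slope u y z (e : 'rV[R]_n) : 'rV[R]_n :=
  gam (dsymbols e G) u y z - gam (dsymbols y G) u z e -
  gam (dsymbols z G) u y e + 2 *: gam G u e (gam G u y z).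

Lemma lsubmx_basisl i : lsubmx (basis (lshift n i) : 'rV[R]_(n + n)) = basis i.
Proof. by apply/rowP => k; rewrite !mxE eq_lshift. Qed.
Lemma lsubmx_basisr i : lsubmx (basis (rshift n i) : 'rV[R]_(n + n)) = 0.
Proof. by apply/rowP => k; rewrite !mxE eq_lrshift andbF. Qed.
Lemma rsubmx_basisl i : rsubmx (basis (lshift n i) : 'rV[R]_(n + n)) = 0.
Proof. by apply/rowP => k; rewrite !mxE eq_rlshift andbF. Qed.
Lemma rsubmx_basisr i : rsubmx (basis (rshift n i) : 'rV[R]_(n + n)) = basis i.
Proof. by apply/rowP => k; rewrite !mxE eq_rshift. Qed.

Lemma dentries0 (g : 'rV[R]_n -> 'M[R]_n) u : dentries 0 g u = 0.
Proof. by apply/matrixP => i j; rewrite mxE derive0 mxE. Qed.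

Lemma gam_dsymbols0 (H : christoffel R n) u x y : gam (dsymbols 0 H) u x y = 0.
Proof.
apply/rowP => k; rewrite mxE big1 ?mxE // => i _; rewrite big1 // => j _.
by rewrite /dsymbols derive0 mulr0.
Qed.

Fact koszul_identity (a b c d e f p q r : R) :
  a + - 2 * (d + p) + (b + - 2 * (e + q)) - (c + - 2 * (f + r)) =
  a + b - c - 2 * (d + e - f) - 2 * (p + q - r).
Proof. ring. Qed.

Lemma koszul_riem_ext w Y Z l : W w -> koszul (riem_ext G phi) w Y Z 0 l =
  let u := lsubmx w in let y := lsubmx Y in let z := lsubmx Z in
  let e := lsubmx (basis l) in let om := rsubmx w in
  (bil (dentries y phi u) z e + bil (dentries z phi u) y e - bil (dentries e phi u) y z) -
  2 * (dot (rsubmx Y) (gam G u z e) + dot (rsubmx Z) (gam G u y e) -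
       dot (rsubmx (basis l)) (gam G u y z)) -
  2 * (dot om (gam (dsymbols y G) u z e) + dot om (gam (dsymbols z G) u y e) -
       dot om (gam (dsymbols e G) u y z)).
Proof.
move=> Ww /=.
have BD V X' Y' := bil_dentries_riem_ext (phi := phi) oU sG sphi V X' Y' Ww.
transitivity (bil (dentries Y (riem_ext G phi) w) Z (basis l) +
  bil (dentries Z (riem_ext G phi) w) Y (basis l) -
  bil (dentries (basis l) (riem_ext G phi) w) Y Z); first by rewrite /koszul mxE.
apply: etrans (congr2 (fun a b => a - b) (congr2 +%R (BD Y Z _) (BD Z Y _)) (BD _ Y Z)) _.
exact: (koszul_identity _ _ _ (dot (rsubmx Y) _)).
Qed.

Fact half_identity (a b c d e f p q r s : R) :
  2^-1 * (a + b - c - 2 * (e + f - 0) - 2 * (p + q - r) + - 2 * (d + - 2 * s)) =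
  2^-1 * (a + b - c) - d - e - f + (r - p - q + 2 * s).
Proof. by field. Qed.

(** The inverse metric exchanges base and fibre components up to a shear, so the
    base component is half of the fibre part of the Koszul form, that is, minus
    half of the derivatives along the fibres of the horizontal block; this is the
    original connection.  The shear contributes the quadratic terms in [G]. *)
Lemma gam_riem_ext w Y Z : W w -> gam LC w Y Z =
  row_mx (gam G (lsubmx w) (lsubmx Y) (lsubmx Z))
    (\row_k (fiber_part (lsubmx w) Y Z (basis k) +
             dot (rsubmx w) (fiber_slope (lsubmx w) (lsubmx Y) (lsubmx Z) (basis k)))).
Proof.
move=> Ww; rewrite (levi_civitaE Y Z oW (smooth_riem_ext oU sG sphi) Ww).
set u := lsubmx w; set y := lsubmx Y; set z := lsubmx Z.
have Kr : rsubmx (koszul (riem_ext G phi) w Y Z) = 2 *: gam G u y z.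
  apply/rowP => k; rewrite [LHS]mxE [RHS]mxE (koszul_riem_ext Y Z _ Ww) /=.
  rewrite lsubmx_basisr rsubmx_basisr -/u -/y -/z dot_basisl.
  rewrite !bil0r dentries0 bil0m gam_dsymbols0 (linear0 (gam G u z)) (linear0 (gam G u y)).
  rewrite (linear0 (gam _ u z)) (linear0 (gam _ u y)).
  rewrite !(linear0 (dot _ : 'rV[R]_n -> R^o)).
  by move: (gam _ _ _ _ _ _) => a; ring.
rewrite invmx_riem_ext tr_block_mx !trmx0 !trmx1 -[koszul _ _ _ _]hsubmxK Kr.
rewrite mul_row_block !(mulmx0, mulmx1, add0r) scale_row_mx scalerA.
rewrite mulVf ?pnatr_eq0 // scale1r; congr row_mx.
apply/rowP => k; rewrite [LHS]mxE [RHS]mxE.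
have Kl : lsubmx (koszul (riem_ext G phi) w Y Z) 0 k =
    koszul (riem_ext G phi) w Y Z 0 (lshift n k) by rewrite mxE.
have Hk : (2 *: gam G u y z *m (- riem_ext_h G phi w)^T) 0 k =
    - 2 * bil (riem_ext_h G phi w) (basis k) (gam G u y z).
  rewrite mxE bil_basisl mulr_sumr; apply: eq_bigr => j _.
  by rewrite [X in X * _ = _]mxE [X in _ * X = _]mxE [X in _ * X = _]mxE; ring.
rewrite [X in _ * X]mxE Kl Hk bil_riem_ext_h -/u (koszul_riem_ext Y Z _ Ww) /=.
rewrite lsubmx_basisl rsubmx_basisl -/u -/y -/z dot0l.
rewrite /fiber_part -/y -/z /fiber_slope (dotDr (rsubmx w) _ (2 *: _)) dotZr !dotBr.
apply: (half_identity (bil (dentries y phi u) z (basis k)) (bil (dentries z phi u) y (basis k))).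
Qed.
Lemma smooth_symbols_riem_ext : smooth_symbols W LC.
Proof.
have se := smooth_riem_ext oU sG sphi.
have sI k l : smooth_on W (fun w =>
    (block_mx 0 1%:M 1%:M (- riem_ext_h G phi w) : 'M[R]_(n + n)) k l).
  have sc (c : R) f : (forall w, f w = c) -> smooth_on W f.
    by move=> fc; apply: (smooth_on_eq oW _ (smooth_cst c)) => w _.
  case: (split_ordP k) => {}k ->; case: (split_ordP l) => {}l ->.
  - by apply: (sc 0) => w; rewrite block_mxEul mxE.
  - by apply: (sc (1%:M k l)) => w; rewrite block_mxEur.
  - by apply: (sc (1%:M k l)) => w; rewrite block_mxEdl.
  apply: (smooth_on_eq oW (f := fun w =>
      cst (- 1) w * riem_ext G phi w (lshift n k) (lshift n l))).
    by move=> w _; rewrite block_mxEdr /riem_ext block_mxEul [RHS]mxE mulN1r.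
  exact: (smooth_onM oW (smooth_cst _) (se _ _)).
move=> i j k.
pose t l w := 'D_(basis i) (fun v => riem_ext G phi v j l) w +
  'D_(basis j) (fun v => riem_ext G phi v i l) w +
  cst (- 1) w * 'D_(basis l) (fun v => riem_ext G phi v i j) w.
apply: (smooth_on_eq (f := fun w => cst (2^-1) w * \sum_l
  (block_mx 0 1%:M 1%:M (- riem_ext_h G phi w) : 'M[R]_(n + n)) k l * t l w) oW).
  move=> w _; rewrite /LC /levi_civita invmx_riem_ext; congr (_ * _).
  by apply: eq_bigr => l _; rewrite /t mulN1r.
apply: (smooth_onM oW (smooth_cst _)); apply: smooth_on_sum => // l.
apply: (smooth_onM oW (sI k l)); apply: smooth_onD => //.
  by apply: smooth_onD => //; apply: smooth_onS; exact: se.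
by apply: (smooth_onM oW (smooth_cst _)); apply: smooth_onS; exact: se.
Qed.

End ExtensionConnection.

(** * Curvature and Szabo operator on vertical vectors *)

Section DualTranspose.
Context {R : realType} {n : nat}.
Implicit Types (al v : 'rV[R]_n).

(** The covector alpha o F, for a linear map F. *)
Definition pullback al (F : 'rV[R]_n -> 'rV[R]_n) : 'rV[R]_n := \row_k dot al (F (basis k)).

Lemma pullbackE al F k : pullback al F 0 k = dot al (F (basis k)).
Proof. by rewrite mxE. Qed.

Lemma row_addE (a b : 'rV[R]_n) k : (a + b) 0 k = a 0 k + b 0 k.
Proof. by rewrite mxE. Qed.

Lemma row_oppE (a : 'rV[R]_n) k : (- a) 0 k = - a 0 k.
Proof. by rewrite mxE. Qed.

Lemma dot_pullback al F v : (forall v, F v = \sum_k v 0 k *: F (basis k)) ->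
  dot (pullback al F) v = dot al (F v).
Proof.
move=> ->; rewrite dot_sumr; apply: eq_bigr => k _.
by rewrite mxE dotZr mulrC.
Qed.

Fact curv_identity al (a b c d f : 'rV[R]_n) :
  dot al (a - b - c + 2 *: d) - - dot al b + (- dot al d - - - dot al f) =
  dot al (a - c + (d - f)).
Proof. rewrite !(dotDr, dotNr, dotZr); ring. Qed.

Fact szabo_identity al (a b c d f : 'rV[R]_n) :
  dot al a - dot al b - - dot al c - dot al d - dot al f =
  dot al (a + c - b - f - d).
Proof. rewrite !(dotDr, dotNr); ring. Qed.
End DualTranspose.

(** The connection of the extension enters only through the shape of its symbols,
    which is therefore taken as a hypothesis on an otherwise arbitrary [LC]. *)
Section VerticalCurvature.
Context {R : realType} {n : nat}.
Implicit Types (u y z al : 'rV[R]_n) (w V X Y Z : 'rV[R]_(n + n)).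
Variables (U : set 'rV[R]_n) (G : christoffel R n) (phi : 'rV[R]_n -> 'M[R]_n).
Hypotheses (oU : open U) (sG : smooth_symbols U G).
Hypothesis Gsym : forall u i j k, U u -> G u i j k = G u j i k.

Let W : set 'rV[R]_(n + n) := lsubmx @^-1` U.
Let oW : open W. Proof. exact: open_lsubmx. Qed.
Variable LC : christoffel R (n + n).
Hypothesis smooth_LC : smooth_symbols W LC.
Hypothesis gam_LC : forall w Y Z, W w -> gam LC w Y Z =
  row_mx (gam G (lsubmx w) (lsubmx Y) (lsubmx Z))
    (\row_k (fiber_part G phi (lsubmx w) Y Z (basis k) +
             dot (rsubmx w) (fiber_slope G (lsubmx w) (lsubmx Y) (lsubmx Z) (basis k)))).

Lemma lsubmx_gam_LC w Y Z : W w ->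
  lsubmx (gam LC w Y Z) = gam G (lsubmx w) (lsubmx Y) (lsubmx Z).
Proof. by move=> Ww; rewrite (gam_LC Y Z Ww) row_mxKl. Qed.

Lemma lsubmx_ddir V (F : 'rV[R]_(n + n) -> 'rV[R]_(n + n)) (f : 'rV[R]_n -> 'rV[R]_n) w :
  W w -> (forall w, W w -> lsubmx (F w) = f (lsubmx w)) ->
  lsubmx (ddir V F w) = ddir (lsubmx V) f (lsubmx w).
Proof.
move=> Ww Ff; apply/rowP => k; rewrite [LHS]mxE [LHS]mxE [RHS]mxE.
apply: etrans _ (derive_lsubmx (fun u => f u 0 k) w V).
by apply: (derive_eq_on V oW _ Ww) => v Wv; rewrite -(Ff v Wv) mxE.
Qed.

Lemma rsubmx_ddir V (F : 'rV[R]_(n + n) -> 'rV[R]_(n + n)) (f : 'rV[R]_n -> 'rV[R]_n) w :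
  W w -> (forall w, W w -> rsubmx (F w) = f (lsubmx w)) ->
  rsubmx (ddir V F w) = ddir (lsubmx V) f (lsubmx w).
Proof.
move=> Ww Ff; apply/rowP => k; rewrite [LHS]mxE [LHS]mxE [RHS]mxE.
apply: etrans _ (derive_lsubmx (fun u => f u 0 k) w V).
by apply: (derive_eq_on V oW _ Ww) => v Wv; rewrite -(Ff v Wv) mxE.
Qed.

Lemma lsubmx_gam_dsymbols_LC V w Y Z : W w ->
  lsubmx (gam (dsymbols V LC) w Y Z) =
  gam (dsymbols (lsubmx V) G) (lsubmx w) (lsubmx Y) (lsubmx Z).
Proof.
move=> Ww; rewrite -(ddir_gam_cst V Y Z oW smooth_LC Ww).
rewrite -(ddir_gam_cst _ _ _ oU sG Ww).
by apply: lsubmx_ddir => // v Wv; exact: lsubmx_gam_LC.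
Qed.

(** [LC] covers [G], and derivatives of functions of the base point only see the base
    component of the direction. *)
Lemma lsubmx_curv_LC w X Y Z : W w ->
  lsubmx (curv LC w X Y Z) = curv G (lsubmx w) (lsubmx X) (lsubmx Y) (lsubmx Z).
Proof.
move=> Ww; rewrite /curv linearD !linearB /=.
by rewrite !lsubmx_gam_dsymbols_LC // !lsubmx_gam_LC.
Qed.

Lemma lsubmx_szabo_LC w X Y : W w ->
  lsubmx (szabo_vector LC w X Y) = szabo_vector G (lsubmx w) (lsubmx X) (lsubmx Y).
Proof.
move=> Ww; rewrite /szabo_vector !linearB linearD /=.
rewrite !lsubmx_curv_LC // !lsubmx_gam_LC // lsubmx_curv_LC //.
rewrite (lsubmx_ddir X (f := fun u => curv G u (lsubmx Y) (lsubmx X) (lsubmx X)) Ww) //.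
by move=> v Wv; exact: lsubmx_curv_LC.
Qed.

(** On vertical vectors the extension acts as the dual of [G]. *)
Lemma gam_LC_fiberl w al Z : W w -> gam LC w (row_mx 0 al) Z =
  row_mx 0 (- pullback al (gam G (lsubmx w) (lsubmx Z))).
Proof.
move=> Ww; rewrite (gam_LC _ _ Ww) row_mxKl gam0l; congr row_mx.
apply/rowP => k; rewrite [LHS]mxE [RHS]mxE [pullback _ _ _ _]mxE.
rewrite /fiber_part /fiber_slope row_mxKl row_mxKr dentries0 gam_dsymbols0 !gam0l.
rewrite !bil0m !bil0l !bil0r !(linear0 (gam _ _ _)) scaler0 !(subr0, addr0).
rewrite !(linear0 (dot _ : 'rV[R]_n -> R^o)) mulr0 !subr0 !add0r.
by rewrite addr0.
Qed.

Lemma gam_LC_fiberr w al Y : W w -> gam LC w Y (row_mx 0 al) =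
  row_mx 0 (- pullback al (gam G (lsubmx w) (lsubmx Y))).
Proof.
move=> Ww; rewrite (gam_LC _ _ Ww) row_mxKl linear0; congr row_mx.
apply/rowP => k; rewrite [LHS]mxE [RHS]mxE [pullback _ _ _ _]mxE.
rewrite /fiber_part /fiber_slope row_mxKl row_mxKr dentries0 gam_dsymbols0 !gam0l.
rewrite !bil0m !bil0l !bil0r !(linear0 (gam _ _ _)) scaler0 !(subr0, addr0).
rewrite !(linear0 (dot _ : 'rV[R]_n -> R^o)) mulr0 !subr0 !add0r.
by rewrite bil0r oppr0 add0r addr0.
Qed.

(** The derivative along the fibre of an affine function is its slope. *)
Lemma gam_dsymbols_fiber w al Y Z : W w -> gam (dsymbols (row_mx 0 al) LC) w Y Z =
  row_mx 0 (pullback al (fiber_slope G (lsubmx w) (lsubmx Y) (lsubmx Z))).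
Proof.
move=> Ww; rewrite -(ddir_gam_cst _ _ _ oW smooth_LC Ww).
rewrite -[LHS]hsubmxK; congr row_mx.
  rewrite (lsubmx_ddir _ (f := fun u => gam G u (lsubmx Y) (lsubmx Z)) Ww).
    by rewrite row_mxKl; apply/rowP => k; rewrite !mxE derive0.
  by move=> v Wv; exact: lsubmx_gam_LC.
apply/rowP => k; rewrite [LHS]mxE [LHS]mxE [RHS]mxE.
apply: etrans _ (derive_along_fiber (fun u => fiber_part G phi u Y Z (basis k))
  (fun u => fiber_slope G u (lsubmx Y) (lsubmx Z) (basis k)) w al).
apply: (derive_eq_on _ oW _ Ww) => v Wv.
by rewrite (gam_LC Y Z Wv) row_mxEr mxE.
Qed.

Lemma ddir_pullback y al (F : 'rV[R]_n -> 'rV[R]_n -> 'rV[R]_n) u :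
  U u -> (forall e, smooth_field U (F^~ e)) ->
  ddir y (fun v => pullback al (F v)) u = pullback al (fun e => ddir y (F^~ e) u).
Proof.
move=> Uu sF; apply/rowP => k; rewrite [LHS]mxE [RHS]mxE.
have st i : smooth_on U (fun v => cst (al 0 i) v * F v (basis k) 0 i).
  exact: (smooth_onM oU (smooth_cst _) (sF (basis k) i)).
rewrite (derive_eq_on (g := fun v => \sum_i cst (al 0 i) v * F v (basis k) 0 i) y oU _ Uu);
  last by move=> v _; rewrite mxE.
rewrite (derive_smooth_sum y st Uu); apply: eq_bigr => i _.
rewrite (derive_smoothM y (smooth_cst _) (sF (basis k) i) Uu) derive_cst mulr0 addr0.
by rewrite [ddir _ _ _ _ _]mxE.
Qed.

Lemma gam_dsymbols_LC_fiberl w al Y Z : W w -> gam (dsymbols Y LC) w (row_mx 0 al) Z =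
  row_mx 0 (- pullback al (gam (dsymbols (lsubmx Y) G) (lsubmx w) (lsubmx Z))).
Proof.
move=> Ww; rewrite -(ddir_gam_cst _ _ _ oW smooth_LC Ww).
rewrite -[LHS]hsubmxK; congr row_mx.
  rewrite (lsubmx_ddir _ (f := cst 0) Ww) ?ddir_cst //.
  by move=> v Wv; rewrite (gam_LC_fiberl al Z Wv) row_mxKl.
pose F u := pullback (- al) (gam G u (lsubmx Z)).
have N u : - pullback al (gam G u (lsubmx Z)) = F u.
  by apply/rowP => k; rewrite [LHS]mxE [RHS]mxE [pullback _ _ _ _]mxE dotNl.
rewrite (rsubmx_ddir _ (f := F) Ww); last first.
  by move=> v Wv; rewrite (gam_LC_fiberl al Z Wv) row_mxKr N.
rewrite /F (@ddir_pullback (lsubmx Y) (- al) (fun u e => gam G u (lsubmx Z) e)) //; last first.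
  by move=> e; exact: smooth_gam_cst.
apply/rowP => k; rewrite [LHS]mxE [RHS]mxE [pullback _ _ _ _]mxE dotNl; congr (- dot _ _).
exact: (ddir_gam_cst _ _ _ oU sG Ww).
Qed.

Lemma gam_sym u x y : U u -> gam G u x y = gam G u y x.
Proof.
move=> Uu; apply/rowP => k; rewrite [LHS]mxE [RHS]mxE exchange_big; apply: eq_bigr => i _.
by apply: eq_bigr => j _; rewrite Gsym // [x 0 j * _]mulrC.
Qed.

Lemma gam_dsymbols_sym u v x y : U u -> gam (dsymbols v G) u x y = gam (dsymbols v G) u y x.
Proof.
move=> Uu; rewrite -!(ddir_gam_cst _ _ _ oU sG Uu).
by apply: (ddir_eq v oU _ Uu) => w Uw; exact: gam_sym.
Qed.

(** The last two arguments are exchanged: this is the pair symmetry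
    g(R(alpha, Y) Z, E) = g(R(E, Z) Y, alpha) of the curvature of the metric, obtained
    here from [fiber_slope].  The derivative of [G] along y cancels between the slope
    and the derivative of the dual connection. *)
Lemma curv_LC_fiber w al Y Z : W w -> curv LC w (row_mx 0 al) Y Z =
  row_mx 0 (pullback al (fun e => curv G (lsubmx w) e (lsubmx Z) (lsubmx Y))).
Proof.
move=> Ww; rewrite /curv (gam_dsymbols_fiber al Y Z Ww) (gam_dsymbols_LC_fiberl al Y Z Ww).
rewrite (gam_LC_fiberl al _ Ww) (gam_LC_fiberl al Z Ww) (gam_LC_fiberr _ Y Ww).
rewrite (lsubmx_gam_LC Y Z Ww).
rewrite !opp_row_mx !add_row_mx !oppr0 !addr0; congr row_mx.
set u := lsubmx w; set y := lsubmx Y; set z := lsubmx Z.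
have Uu : U u by [].
have E e : dot (pullback al (gam G u z)) (gam G u y e) = dot al (gam G u z (gam G u y e)).
  by apply: dot_pullback => v; exact: gam_coordr.
apply/rowP => k; rewrite !(row_addE, row_oppE, pullbackE) dotNl E.
set e := basis k.
rewrite /fiber_slope /curv (gam_sym (gam G u y z) e Uu).
rewrite (gam_dsymbols_sym e z y Uu) (gam_dsymbols_sym z e y Uu) (gam_sym z y Uu) (gam_sym e y Uu).
exact: curv_identity.
Qed.

(** The exchange of arguments in [curv_LC_fiber] is harmless, since the Szabo
    operator repeats x in these places and sums over both positions of
    Gamma(x, x).  The dual connection exchanges the roles of the two remaining
    terms, Gamma(x, -) after the curvature and Gamma(x, -) before it, together with
    their signs. *)
Lemma szabo_LC_fiber w X al : W w -> szabo_vector LC w X (row_mx 0 al) =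
  row_mx 0 (pullback al (szabo_vector G (lsubmx w) (lsubmx X))).
Proof.
move=> Ww.
set u := lsubmx w; set x := lsubmx X.
have Uu : U u by [].
rewrite /szabo_vector (gam_LC_fiberr al X Ww) !(curv_LC_fiber _ X X Ww).
rewrite (curv_LC_fiber al (gam LC w X X) X Ww) (curv_LC_fiber al X (gam LC w X X) Ww).
rewrite (gam_LC_fiberr _ X Ww) (lsubmx_gam_LC X X Ww) -/u -/x.
have -> : ddir X (fun w => curv LC w (row_mx 0 al) X X) w =
    row_mx 0 (pullback al (fun e => ddir x (fun v => curv G v e x x) u)).
  rewrite -[LHS]hsubmxK; congr row_mx.
    rewrite (lsubmx_ddir X (f := cst 0) Ww) ?ddir_cst //.
    by move=> v Wv; rewrite (curv_LC_fiber al X X Wv) row_mxKl.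
  rewrite (rsubmx_ddir X (f := fun v => pullback al (fun e => curv G v e x x)) Ww).
    rewrite (@ddir_pullback x al (fun v e => curv G v e x x)) //.
    by move=> e; exact: smooth_curv_cst.
  by move=> v Wv; rewrite (curv_LC_fiber al X X Wv) row_mxKr.
rewrite !opp_row_mx !add_row_mx !oppr0 !addr0; congr row_mx.
have E1 e : dot (pullback al (fun e => curv G u e x x)) (gam G u x e) =
    dot al (curv G u (gam G u x e) x x).
  by rewrite dot_pullback // => v; exact: (curv_coordl _ _ _ sG Uu).
have E2 e : dot (pullback al (gam G u x)) (curv G u e x x) =
    dot al (gam G u x (curv G u e x x)).
  by apply: dot_pullback => v; exact: gam_coordr.
apply/rowP => k; rewrite !(row_addE, row_oppE, pullbackE) !dotNl E1 E2 /szabo_vector -/u -/x.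
exact: szabo_identity.
Qed.
End VerticalCurvature.

(** * Nilpotent matrices and the neutral form *)

Section Nilpotent.
Context {F : fieldType}.

Lemma monic_dvdXn (p : {poly F}) m : p \is monic -> (p %| 'X^m)%R -> p = 'X^((size p).-1).
Proof.
move=> mp; have -> : 'X^m = ('X - 0%:P) ^+ m :> {poly F} by rewrite subr0.
case/dvdp_exp_XsubCP => k _; rewrite subr0 eqp_monic ?monicXn // => /eqP ->.
by rewrite size_polyXn.
Qed.

(** If A^k = 0, then 'X - A divides 'X^k - A^k = 'X^k, so det ('X - A) divides a power
    of 'X. *)
Lemma nilpotent_char_poly n (A : 'M[F]_n.+1) k : A ^+ k = 0 -> char_poly A = 'X^(n.+1).
Proof.
move=> Ak; suff /monic_dvdXn -> : char_poly A %| 'X^(k * n.+1).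
- by rewrite size_char_poly.
- exact: char_poly_monic.
rewrite exprM -[X in _ %| X]det_scalar.
have -> : ('X ^+ k)%:M = 'X%:M ^+ k - (map_mx polyC A) ^+ k :> 'M[{poly F}]_n.+1.
  by rewrite -!rmorphXn /= Ak raddf0 subr0.
rewrite subrXX_comm; last exact: comm_scalar_mx.
by rewrite detM dvdp_mulr.
Qed.

Lemma char_poly_nilpotent n (A : 'M[F]_n.+1) : char_poly A = 'X^(n.+1) -> A ^+ n.+1 = 0.
Proof.
by move=> cA; have := Cayley_Hamilton A; rewrite cA rmorphXn /= horner_mx_X.
Qed.

Lemma char_poly_trmx n (A : 'M[F]_n) : char_poly A^T = char_poly A.
Proof.
rewrite /char_poly -[RHS]det_tr; congr (\det _).
by rewrite /char_poly_mx linearB /= tr_scalar_mx map_trmx.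
Qed.

Lemma char_poly_ublock m n (A : 'M[F]_m) (B : 'M[F]_(m, n)) (C : 'M[F]_n) :
  char_poly (block_mx A B 0 C) = char_poly A * char_poly C.
Proof.
rewrite /char_poly -(det_ublock _ (- map_mx polyC B)); congr (\det _).
rewrite /char_poly_mx map_block_mx map_mx0 scalar_mx_block opp_block_mx add_block_mx.
by rewrite !add0r oppr0.
Qed.

End Nilpotent.

Section Signature.
Context {R : realType} {n : nat}.
(** The rows of the frame are e_i corrected by the vertical vectors that turn
    the product A of the e_i into 1 and into -1. *)
Lemma neutral_block (A : 'M[R]_n) : A^T = A ->
  exists2 P : 'M[R]_(n + n), P \in unitmx &
    P *m block_mx A 1%:M 1%:M 0 *m P^T = block_mx 1%:M 0 0 (- 1%:M).
Proof.
move=> As; pose B := 2^-1 *: (1%:M - A); pose C := - 2^-1 *: (1%:M + A).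
have Bs : B^T = B by rewrite /B linearZ linearB /= trmx1 As.
have Cs : C^T = C by rewrite /C linearZ linearD /= trmx1 As.
have E : block_mx 1%:M B 1%:M C *m block_mx A 1%:M 1%:M 0 *m (block_mx 1%:M B 1%:M C)^T =
    block_mx 1%:M 0 0 (- 1%:M).
  rewrite tr_block_mx trmx1 Bs Cs !mulmx_block !(mulmx1, mul1mx, mulmx0, addr0).
  by congr block_mx; apply/matrixP => i j; rewrite !mxE; field.
exists (block_mx 1%:M B 1%:M C) => //.
have : block_mx 1%:M B 1%:M C *m
    (block_mx A 1%:M 1%:M 0 *m (block_mx 1%:M B 1%:M C)^T *m block_mx 1%:M 0 0 (- 1%:M)) = 1%:M.
  rewrite 2!mulmxA E mulmx_block !(mulmx1, mul1mx, mulmx0, mul0mx, addr0, add0r).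
  by rewrite mulNmx mul1mx opprK -scalar_mx_block.
by move/mulmx1_unit => [].
Qed.
End Signature.

(** * The equivalence *)

Section SzaboExt.
Context {R : realType} {n : nat}.
Variables (U : set 'rV[R]_n) (G : christoffel R n) (phi : 'rV[R]_n -> 'M[R]_n).
Hypotheses (oU : open U) (sG : smooth_symbols U G) (sphi : smooth_mx U phi).
Hypothesis Gsym : forall u i j k, U u -> G u i j k = G u j i k.

Lemma szabo_operator_riem_ext w (X : 'rV[R]_(n + n)) : U (lsubmx w) ->
  exists B, szabo_operator (levi_civita (riem_ext G phi)) w X =
    block_mx (szabo_operator G (lsubmx w) (lsubmx X)) B
             0 (szabo_operator G (lsubmx w) (lsubmx X))^T.
Proof.
move=> Uw; set LC := levi_civita _; set S := szabo_operator G _ _.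
have oW : open (lsubmx @^-1` U : set 'rV[R]_(n + n)) by exact: open_lsubmx.
have sLC : smooth_symbols (lsubmx @^-1` U : set 'rV[R]_(n + n)) LC.
  exact: smooth_symbols_riem_ext.
have LCE := gam_riem_ext oU sG sphi.
have SE i j := szabo_operatorE (lsubmx X) i j oU sG Uw.
exists (ursubmx (szabo_operator LC w X)); rewrite -[LHS]submxK.
congr block_mx; apply/matrixP => i j; rewrite [LHS]mxE [LHS]mxE.
- rewrite (szabo_operatorE X (lshift n i) (lshift n j) oW sLC Uw) /S SE.
  have := lsubmx_szabo_LC oU sG sLC LCE X (basis (lshift n i)) Uw.
  by rewrite lsubmx_basisl => <-; rewrite [RHS]mxE.
- rewrite (szabo_operatorE X (rshift n i) (lshift n j) oW sLC Uw).
  rewrite -[basis (rshift n i)]hsubmxK lsubmx_basisr.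
  by rewrite (szabo_LC_fiber oU sG Gsym sLC LCE) // row_mxEl !mxE.
- rewrite (szabo_operatorE X (rshift n i) (rshift n j) oW sLC Uw) [RHS]mxE /S SE.
  rewrite -[basis (rshift n i)]hsubmxK lsubmx_basisr rsubmx_basisr.
  by rewrite (szabo_LC_fiber oU sG Gsym sLC LCE) // row_mxEr mxE dot_basisl.
Qed.

Lemma szabo_operator0 u : U u -> szabo_operator G u 0 = 0.
Proof.
move=> Uu; apply/matrixP => i j; rewrite (szabo_operatorE 0 i j oU sG Uu) [RHS]mxE.
have c0 x z : curv G u x 0 z = 0.
  by rewrite /curv !gam0l linear0 gam_dsymbols0 !subr0 addr0.
have d0 (F : 'rV[R]_n -> 'rV[R]_n) : ddir 0 F u = 0.
  by apply/rowP => k; rewrite !mxE derive0.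
by rewrite /szabo_vector d0 !gam0l !c0 !subr0 addr0 mxE.
Qed.
End SzaboExt.

Lemma eigen_mult_char_poly (R : realType) n (A B : 'M[R]_n) lam :
  char_poly A = char_poly B -> eigen_mult A lam = eigen_mult B lam.
Proof. by move=> AB; rewrite /eigen_mult -!map_char_poly AB. Qed.

(** Affine Szabo is compared with the vanishing of all but the leading coefficient
    of every characteristic polynomial, by taking one of the two vectors zero. *)
Theorem dre_nilpotent_szabo (R : realType) n (M : manifold R n.+1)
    (D : affine_connection M) (phi : sym_tensor2 M) :
  affine_szabo D <-> nilpotent_szabo (deformed_riemannian_extension D phi).
Proof.
have oU a := dom_open M a.
have sD a := symbols_smooth (a := a) D.
have sphi a := comps_smooth (a := a) phi.
have Dsym (a : chart M) u i j k : dom a u -> D a u i j k = D a u j i k by exact: torsion_free.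
have blk a w X := szabo_operator_riem_ext (oU a) (sD a) (sphi a) (Dsym a) (w := w) X.
split=> [szD|[_ nil] p a pa].
- have cS (a : chart M) u x : dom a u -> char_poly (szabo_operator (D a) u x) = 'X^(n.+1).
    move=> du; have pu : Defs.patch a (param a u) by exists u.
    have E := szD (param a u) a pu x 0; rewrite (paramK du) in E.
    apply: etrans E _; rewrite (szabo_operator0 (oU a) (sD a) du).
    by apply: (nilpotent_char_poly (k := 1)); rewrite expr1.
  have cT (a : chart (cotangent_bundle M)) w X : dom a w ->
      char_poly (szabo_operator (levi_civita (deformed_riemannian_extension D phi a)) w X) =
      'X^(n.+1 + n.+1).
    move=> dw; have [B ->] := blk a w X dw.
    by rewrite char_poly_ublock char_poly_trmx (cS a _ _ dw) exprD.
  split=> [eps _ a b u v x y du dv _ _ lam|a u x du].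
    apply: eigen_mult_char_poly; exact: etrans (cT a u x du) (esym (cT b v y dv)).
  by exists (n.+1 + n.+1)%N; apply: char_poly_nilpotent; exact: cT.
have [du pu] := patch_coord pa.
suff cS x : char_poly (szabo_operator (D a) (Defs.coord a p) x) = 'X^(n.+1).
  by move=> x y; exact: etrans (cS x) (esym (cS y)).
pose w : 'rV[R]_(n.+1 + n.+1) := row_mx (Defs.coord a p) 0.
pose X : 'rV[R]_(n.+1 + n.+1) := row_mx x 0.
have dw : dom (m := M) a (lsubmx w) by rewrite row_mxKl.
have [k Sk] := nil a w X dw.
have E : char_poly (szabo_operator (levi_civita (deformed_riemannian_extension D phi a)) w X)
    = 'X^(n.+1 + n.+1) := nilpotent_char_poly Sk.
have [B EB] := blk a w X dw; move: E.
rewrite {1}EB char_poly_ublock !row_mxKl => E.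
have dv : char_poly (szabo_operator (D a) (Defs.coord a p) x) %| 'X^(n.+1 + n.+1).
  by rewrite -E dvdp_mulr.
by rewrite (monic_dvdXn (char_poly_monic _) dv) size_char_poly.
Qed.

Lemma dre_pseudo_riemannian (R : realType) n (M : manifold R n)
    (D : affine_connection M) (phi : sym_tensor2 M) :
  pseudo_riemannian n n (deformed_riemannian_extension D phi).
Proof.
move=> a w dw; apply: neutral_block.
have := dre_sym D phi dw.
by rewrite /dre_comps tr_block_mx => /eq_block_mx [].
Qed.

Theorem theorem4p1 (R : realType) (M : manifold R 2)
    (D : affine_connection M) (phi : sym_tensor2 M) :
  affine_szabo D <->
  pseudo_riemannian 2 2 (deformed_riemannian_extension D phi) /\
  nilpotent_szabo (deformed_riemannian_extension D phi).
Proof.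
split=> [/(dre_nilpotent_szabo D phi)|[_]]; last by move/(dre_nilpotent_szabo D phi).
by split=> //; exact: dre_pseudo_riemannian.
Qed.
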